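(* Let $n\ge1$ and let $x=(x_1,\dots,x_{2n})$ be indeterminates. Then \begin{align*} A_{\mathrm{OD}}(2n;x;\zeta_4)&=2^{-2n^2+2n}\prod_{i=1}^{2n}x_i^{-2n+2}\prod_{1\le i<j\le2n}(1+x_i^2x_j^2)\,\operatorname{Hf}\Big(\frac{1}{1+x_i^2x_j^2}\Big)_{1\le i,j\le2n},\\ A_{\mathrm{OD}}(2n;x;\zeta_6)&=3^{-n^2+n}\,\mathrm{Sp}_{4n}\big(\delta(n-1,n-1);x_1^2,\dots,x_{2n}^2\big). \end{align*}
   Context: $\sigma(t)=t-t^{-1}$, $\zeta_m=\exp(2\pi\sqrt{-1}/m)$. For a parameter $a$ let $M_{\mathrm{OD}}(n;x;a)$ be the skew-symmetric $2n\times2n$ matrix with entries $\dfrac{\sigma(x_j/x_i)}{\sigma(ax_ix_j)\sigma(a/(x_ix_j))}$, let $F_{\mathrm{OD}}(n;x;a)=\dfrac{\prod_{1\le i<j\le2n}\sigma(ax_ix_j)\sigma(a/(x_ix_j))}{\prod_{1\le i<j\le2n}\sigma(x_j/x_i)}$, and $A_{\mathrm{OD}}(2n;x;a)=\sigma(a)^{-2n^2+2n}F_{\mathrm{OD}}(n;x;a)\operatorname{Pf}M_{\mathrm{OD}}(n;x;a)$. For a symmetric $2n\times2n$ matrix $B$, $\operatorname{Hf}B$ is the sum over all perfect matchings of $\{1,\dots,2n\}$ of the product of the entries $B_{ij}$ over the matched pairs. For $r\in\mathbb Z$, $\delta(r)=(r,r-1,\dots)$ consists of all $r-k\ge0$ ($k\in\mathbb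 Z_{\ge0}$), empty if $r<0$; $\delta(r,s)$ arranges the entries of $\delta(r)$ and $\delta(s)$ together in non-increasing order (here $\delta(n-1,n-1)$ has exactly $2n$ entries). For a partition $\lambda$ of length $\le N$ and $z=(z_1,\dots,z_N)$, $\mathrm{Sp}_{2N}(\lambda;z)=\det\big(z_i^{\lambda_j+N-j+1}-z_i^{-(\lambda_j+N-j+1)}\big)/\det\big(z_i^{N-j+1}-z_i^{-(N-j+1)}\big)$. *)

(* Defs.v *)
From mathcomp Require Import all_boot all_order all_fingroup all_algebra.
From mathcomp Require Import complex mpoly reals.
From mathcomp Require trigo.

Set Implicit Arguments.
Unset Strict Implicit.
Unset Printing Implicit Defensive.

Import GRing.Theory.
Local Open Scope ring_scope.

(* A perfect matching {i_1 < j_1}, ..., {i_n < j_n} with i_1 < ... < i_n of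
   {0, ..., 2n-1} is encoded by the permutation s with s (2k) = i_{k+1} and
   s (2k+1) = j_{k+1}; the signature of s is the sign of the matching in the
   Pfaffian. *)

Lemma ord_fst_subproof (n : nat) (k : 'I_n) : (2 * k < 2 * n)%N.
Proof. by rewrite ltn_pmul2l. Qed.

Lemma ord_snd_subproof (n : nat) (k : 'I_n) : ((2 * k).+1 < 2 * n)%N.
Proof. by rewrite !mul2n ltn_Sdouble. Qed.

Definition ord_fst (n : nat) (k : 'I_n) : 'I_(2 * n) :=
  Ordinal (ord_fst_subproof k).

Definition ord_snd (n : nat) (k : 'I_n) : 'I_(2 * n) :=
  Ordinal (ord_snd_subproof k).

Definition perfect_matching (n : nat) (s : 'S_(2 * n)) : bool :=
  [forall k : 'I_n, (s (ord_fst k) < s (ord_snd k))%N]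
  && [forall k : 'I_n, forall l : 'I_n,
        (k < l)%N ==> (s (ord_fst k) < s (ord_fst l))%N].

Section Field.

Variable F : fieldType.

Definition Pf (n : nat) (A : 'M[F]_(2 * n)) : F :=
  \sum_(s : 'S_(2 * n) | perfect_matching s)
    (-1) ^+ s * \prod_(k < n) A (s (ord_fst k)) (s (ord_snd k)).

Definition Hf (n : nat) (B : 'M[F]_(2 * n)) : F :=
  \sum_(s : 'S_(2 * n) | perfect_matching s)
    \prod_(k < n) B (s (ord_fst k)) (s (ord_snd k)).

Definition sigma (t : F) : F := t - t^-1.

Definition M_OD (n : nat) (x : 'I_(2 * n) -> F) (a : F) : 'M[F]_(2 * n) :=
  \matrix_(i, j)
    (sigma (x j / x i) / (sigma (a * x i * x j) * sigma (a / (x i * x j)))).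

Definition F_OD (n : nat) (x : 'I_(2 * n) -> F) (a : F) : F :=
  (\prod_(i < 2 * n) \prod_(j < 2 * n | (i < j)%N)
      (sigma (a * x i * x j) * sigma (a / (x i * x j))))
  / (\prod_(i < 2 * n) \prod_(j < 2 * n | (i < j)%N) sigma (x j / x i)).

Definition A_OD (n : nat) (x : 'I_(2 * n) -> F) (a : F) : F :=
  sigma a ^ (- 2 * n%:Z ^+ 2 + 2 * n%:Z) * F_OD x a * Pf (M_OD x a).

(* With 0-based indices i, j < N, the exponents lambda_j + N - j + 1 and
   N - j + 1 become lambda`_j + (N - j) and N - j; parts of the partition
   beyond the end of the sequence are 0. *)
Definition symplectic_num (N : nat) (lambda : seq nat) (z : 'I_N -> F) : F :=
  \det (\matrix_(i < N, j < N)
    (z i ^+ (nth 0%N lambda j + (N - j)) -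
     z i ^- (nth 0%N lambda j + (N - j)))).

(* The symplectic character Sp_{2N}(lambda; z_1, ..., z_N). *)
Definition Sp (N : nat) (lambda : seq nat) (z : 'I_N -> F) : F :=
  symplectic_num lambda z / symplectic_num [::] z.

End Field.

Definition delta (r : int) : seq nat :=
  if r is Posz k then rev (iota 0 k.+1) else [::].

Definition delta2 (r s : int) : seq nat := sort geq (delta r ++ delta s).

(* exp (2 pi sqrt(-1) / m), by Euler's formula *)
Definition zeta (R : realType) (m : nat) : R[i] :=
  Complex (trigo.cos (2 * (trigo.pi : R) / m%:R))
          (trigo.sin (2 * (trigo.pi : R) / m%:R)).

(* The field C(x_1, ..., x_N) of rational functions. *)
Definition ratfun (R : realType) (N : nat) : fieldType :=
  {fraction {mpoly R[i][N]}}.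

Definition indet (R : realType) (N : nat) (i : 'I_N) : ratfun R N :=
  tofrac ('X_i : {mpoly R[i][N]}).

Definition ratfun_const (R : realType) (N : nat) (c : R[i]) : ratfun R N :=
  tofrac (c%:MP : {mpoly R[i][N]}).

(* Main.v *)
(* Put X_i = x_i^2.

   At a = zeta_4 the entries of M_OD are, up to row and column scalings,
   (X_j - X_i) / (1 + X_i X_j)^2, and the first formula becomes
     Pf ((X_j - X_i) / (1 + X_i X_j)^2)
       = prod_{i<j} (X_j - X_i) / (1 + X_i X_j) * Hf (1 / (1 + X_i X_j)).
   Expand both sides along the first variable z. By induction, after clearing
   denominators, this is an identity between two polynomials in z of degree less
   than 2N (N the number of remaining variables), and they agree to second order
   at the N points z = -1/X_m: the values match trivially and the derivatives
   match by a relation between Hafnians with one variable deleted.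

   At a = zeta_6, with alpha = X + 1/X, b = X^3 and u = b + 1/b, the entries are,
   up to scalings, (alpha_j - alpha_i) / (1 - b_i b_j). For free parameters
   (alpha_i, b_i) the Pfaffian of this matrix of size 2n times
   prod_{i<j} (1 - b_i b_j) equals prod_i b_i^(n-1) times the determinant of the
   functions u^k, alpha u^k (k < n): as polynomials in b_z of degree at most 2n-2,
   the two sides agree at the 2n-1 points b_z = 1/b_k, where u_z = u_k makes the
   determinant factor through the one of size 2n-2. Since
   z^(m+6) + z^m = z^(m+3) (z^3 + z^-3), the functions (z^m - z^-m) / (z - 1/z)
   with m = 1, 2, 4, 5, 7, ... are a unitriangular combination of the u^k, alpha u^k,
   and these are the exponents occurring in the numerator of the symplectic
   character. *)
Require Import Defs.
From mathcomp Require Import all_boot all_order all_fingroup all_algebra.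
From mathcomp Require Import complex mpoly reals ring lra zify.
From mathcomp Require trigo.

Set Implicit Arguments.
Unset Strict Implicit.
Unset Printing Implicit Defensive.

Import Order.TTheory GRing.Theory Num.Theory.
Local Open Scope ring_scope.

(** * Sums over perfect matchings *)

Section Del.
Variable T : Type.
Implicit Types (x : T) (s : seq T) (i : nat).

(** Deletion by position, the list counterpart of passing to a minor: surviving positions are
    renumbered by [bump], as [lift] does on ordinals. *)
Fixpoint del i s {struct s} :=
  if s is x :: s' then if i is i'.+1 then x :: del i' s' else s' else [::].

Lemma size_del i s : (i < size s)%N -> size (del i s) = (size s).-1.
Proof.
elim: s i => // x s IHs [|i] //= lti.
by rewrite IHs //; case: (size s) lti.
Qed.

Lemma nth_del d i s k : nth d (del i s) k = nth d s (bump i k).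
Proof.
elim: s i k => [|x s IHs] [|i] k; rewrite ?nth_nil //.
by case: k => // k; rewrite bumpS /= IHs.
Qed.

End Del.

Lemma map_del (T U : Type) (h : T -> U) i s : map h (del i s) = del i (map h s).
Proof. by elim: s i => // x s IHs [|i] //=; rewrite IHs. Qed.

Lemma big_del (K : fieldType) (T : Type) (F : T -> K) d i s : (i < size s)%N ->
  \prod_(x <- s) F x = F (nth d s i) * \prod_(x <- del i s) F x.
Proof.
elim: s i => // x s IHs [|i] /= lti; rewrite !big_cons // (IHs i lti).
by rewrite mulrCA.
Qed.

Lemma del_filter (T : eqType) d i (s : seq T) :
  uniq s -> (i < size s)%N -> del i s = [seq y <- s | y != nth d s i].
Proof.
elim: s i => // x s IHs [|i] /= /andP[xs us] lti.
  rewrite eqxx /=; apply/esym/all_filterP/allP => y ys.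
  by apply: contraNneq xs => <-.
rewrite (IHs i us lti) ifT //.
by apply: contraNneq xs => ->; apply: mem_nth.
Qed.

Section MatchSum.
Variables (K : fieldType) (T : Type).
Implicit Types (e : K) (f : T -> T -> K) (x : T) (s : seq T).

(** The counter [k] is fuel, since [del i s'] is not a subterm of [s]; every [k] of at least
    [size s] gives the same value. *)
Fixpoint msum_rec e f k s : K :=
  if s is x :: s' then
    if k is k'.+1 then
      \sum_(i < size s') e ^+ i * f x (nth x s' i) * msum_rec e f k' (del i s')
    else 0
  else 1.

(* Expansion along the first row: [e = -1] gives the Pfaffian of the matrix
   [f x y] with rows and columns labelled by [s], and [e = 1] its Hafnian. *)
Definition msum e f s := msum_rec e f (size s) s.

Lemma msum_rec_fuel e f k l s : (size s <= k)%N -> (size s <= l)%N ->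
  msum_rec e f k s = msum_rec e f l s.
Proof.
elim: k l s => [|k IHk] [|l] [|x s] //=; rewrite !ltnS => lek lel.
have le k' (i : 'I_(size s)) : (size s <= k')%N -> (size (del i s) <= k')%N.
  by rewrite (size_del (ltn_ord i)); apply: leq_trans (leq_pred _).
by apply: eq_bigr => i _; rewrite (IHk l) ?le.
Qed.

Lemma msum_cons e f x s :
  msum e f (x :: s) =
    \sum_(i < size s) e ^+ i * f x (nth x s i) * msum e f (del i s).
Proof.
apply: eq_bigr => i _; congr (_ * _); apply: msum_rec_fuel => //.
by rewrite (size_del (ltn_ord i)) leq_pred.
Qed.

Lemma msum_ind (P : seq T -> Prop) :
  P [::] -> (forall x s, (forall i, (i < size s)%N -> P (del i s)) -> P (x :: s)) ->
  forall s, P s.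
Proof.
move=> P0 PS s; move: {2}(size s) (leqnn (size s)) => l.
elim: l s => [|l IHl] [|x s] //=; rewrite ltnS => les.
by apply: PS => i lti; apply: IHl; rewrite size_del // (leq_trans _ les) ?leq_pred.
Qed.

(** Every entry lies in exactly one pair of each matching, so its factor comes out once. *)
Lemma msum_scale e f (d : T -> K) s :
  msum e (fun x y => d x * d y * f x y) s = (\prod_(x <- s) d x) * msum e f s.
Proof.
elim/msum_ind: s => [|x s IH]; first by rewrite big_nil mul1r.
rewrite !msum_cons big_cons mulr_sumr; apply: eq_bigr => i _.
rewrite IH //.
by rewrite (big_del d x (ltn_ord i)); ring.
Qed.

End MatchSum.

Lemma msum_map (K : fieldType) (T U : Type) e (f : U -> U -> K) (h : T -> U) s :
  msum e f (map h s) = msum e (fun x y => f (h x) (h y)) s.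
Proof.
elim/msum_ind: s => [|x s IH] //=.
rewrite !msum_cons size_map; apply: eq_bigr => i _.
by rewrite (nth_map x) // -map_del IH.
Qed.

Lemma eq_msum (K : fieldType) (T : eqType) e (f g : T -> T -> K) s :
  uniq s -> {in s &, forall x y, x != y -> f x y = g x y} ->
  msum e f s = msum e g s.
Proof.
elim/msum_ind: s => [|x s IH] //= /andP[xs us] fg.
rewrite !msum_cons; apply: eq_bigr => i _.
rewrite fg ?mem_head ?in_cons ?mem_nth ?orbT //; last first.
  by apply: contraNneq xs => ->; apply: mem_nth.
rewrite IH // ?(del_filter x) ?filter_uniq // => y z.
by rewrite !mem_filter => /andP[_ ys] /andP[_ zs]; apply: fg; rewrite in_cons ?ys ?zs orbT.
Qed.

(** * From permutations encoding matchings to the expansion along the first row *)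

Section Bridge.
Variable K : fieldType.

Lemma lift_perm_inj n (i j : 'I_n.+1) : injective (lift_perm i j).
Proof.
move=> s t st; apply/permP => k; apply: (@lift_inj _ j).
by rewrite -!(lift_perm_lift i) st.
Qed.

Lemma lift_perm_exists n (i j : 'I_n.+1) (s : 'S_n.+1) :
  s i = j -> exists t, s = lift_perm i j t.
Proof.
move=> sij; have lift_s k : exists l, s (lift i k) == lift j l.
  case: (unliftP j (s (lift i k))) => [l -> | sk]; first by exists l.
  by have := neq_lift i k; rewrite -(inj_eq (@perm_inj _ s)) sij sk eqxx.
pose t k := xchoose (lift_s k).
have tP k : s (lift i k) = lift j (t k) by apply/eqP/(xchooseP (lift_s k)).
have t_inj : injective t.
  by move=> k l tkl; apply/(@lift_inj _ i)/(@perm_inj _ s); rewrite !tP tkl.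
exists (perm t_inj); apply/permP => k; case: (unliftP i k) => [l ->|->].
  by rewrite lift_perm_lift tP permE.
by rewrite lift_perm_id.
Qed.

Lemma sum_lift_perm n (i j : 'I_n.+1) (P : pred 'S_n.+1) (G : 'S_n.+1 -> K) :
  \sum_(s | P s && (s i == j)) G s =
    \sum_(t | P (lift_perm i j t)) G (lift_perm i j t).
Proof.
rewrite -(big_imset _ (in2W (@lift_perm_inj n i j))) /=.
apply: eq_bigl => s; apply/andP/imsetP => [[Ps /eqP sij]|[t Pt ->]].
  by have [t st] := lift_perm_exists sij; exists t; rewrite // unfold_in -st.
by rewrite lift_perm_id eqxx.
Qed.

(* The value is junk, namely 0, for [i >= m]. *)
Definition pnat m (s : 'S_m) (i : nat) : nat := oapp (fun k => nat_of_ord (s k)) 0%N (insub i).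

Lemma pnatE m (s : 'S_m) (k : 'I_m) : pnat s k = s k.
Proof. by rewrite /pnat valK. Qed.

Lemma pnat_lift m (j : 'I_m.+1) (s : 'S_m) k : (k < m)%N ->
  pnat (lift_perm ord0 j s) k.+1 = bump j (pnat s k).
Proof.
move=> ltkm; rewrite -[k]/(nat_of_ord (Ordinal ltkm)) pnatE.
have -> : k.+1 = lift ord0 (Ordinal ltkm) by [].
by rewrite pnatE lift_perm_lift.
Qed.

(** [perfect_matching] with [m] kept apart from [n] and positions read as natural numbers, so that
    an induction can pass from [m.+2] to [m] without casts. *)
Definition is_matching n m (s : 'S_m) : bool :=
  [forall k : 'I_n, pnat s k.*2 < pnat s k.*2.+1]%N
  && [forall k : 'I_n, forall l : 'I_n, (k < l) ==> (pnat s k.*2 < pnat s l.*2)]%N.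

Lemma is_matchingP n m (s : 'S_m) :
  reflect ((forall k, k < n -> pnat s k.*2 < pnat s k.*2.+1)
    /\ (forall k l, k < l < n -> pnat s k.*2 < pnat s l.*2))%N (is_matching n s).
Proof.
apply: (iffP andP) => [[/forallP H1 /forallP H2]|[H1 H2]]; split.
- by move=> k ltk; apply: (H1 (Ordinal ltk)).
- move=> k l /andP[kl ln].
  have /forallP/(_ (Ordinal ln))/implyP := H2 (Ordinal (ltn_trans kl ln)).
  by apply.
- by apply/forallP => k; apply: H1.
- apply/forallP => k; apply/forallP => l; apply/implyP => kl.
  by apply: H2; rewrite kl ltn_ord.
Qed.

Lemma ltn_bump j a b : (bump j a < bump j b)%N = (a < b)%N.
Proof. by rewrite !ltnNge leq_bump2. Qed.

(** The lifted permutation starts with the pair of 0 and [j.+1]. Later values are relabelled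
    increasingly by [bump], so their order relations are those of [s]; the conditions on the first
    pair hold because 0 is minimal. *)
Lemma is_matching_lift n m (j : 'I_m.+1) (s : 'S_m) : m = n.*2 ->
  is_matching n.+1 (lift_perm ord0 ord0 (lift_perm ord0 j s)) = is_matching n s.
Proof.
move=> mE; set t := lift_perm _ _ _.
have t0 : pnat t 0 = 0%N by rewrite (pnatE t ord0) lift_perm_id.
have t1 : pnat t 1 = j.+1.
  by rewrite pnat_lift // (pnatE _ ord0) lift_perm_id.
have t2 k : (k < m)%N -> pnat t k.+2 = (bump j (pnat s k)).+1.
  by move=> lt; rewrite !pnat_lift.
have ev k : (k < n)%N -> (k.*2 < m)%N by rewrite mE ltn_double.
have od k : (k < n)%N -> (k.*2.+1 < m)%N by rewrite mE ltn_Sdouble.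
apply/is_matchingP/is_matchingP => -[H1 H2]; split.
- move=> k lt; have := H1 k.+1 lt.
  by rewrite doubleS !t2 ?ev ?od // ltnS ltn_bump.
- move=> k l /andP[kl ln]; have := H2 k.+1 l.+1; rewrite !ltnS kl => /(_ ln).
  by rewrite !doubleS !t2 ?ev ?(ltn_trans kl ln) // ltnS ltn_bump.
- case=> [|k] lt; first by rewrite t0 t1.
  by rewrite doubleS !t2 ?ev ?od // ltnS ltn_bump H1.
- case=> [|k] [|l] // /andP[kl ln]; first by rewrite t0 doubleS t2 ?ev.
  rewrite !ltnS in kl ln.
  by rewrite !doubleS !t2 ?ev ?(ltn_trans kl ln) // ltnS ltn_bump H2 // kl.
Qed.

(** The position of the value 0 cannot be odd, being then the larger end of its pair, nor even and
    positive, since the smaller ends increase. *)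
Lemma is_matching0 n m (s : 'S_m.+2) : m = n.*2 ->
  is_matching n.+1 s -> s ord0 = ord0.
Proof.
move=> mE /is_matchingP[H1 H2].
have [p sp] : exists p : 'I_m.+2, s p = ord0 by exists (s^-1 ord0)%g; rewrite permKV.
suff p0 : nat_of_ord p = 0%N by rewrite -{2}sp; congr (s _); apply/val_inj; rewrite /= p0.
have np : pnat s p = 0%N by rewrite pnatE sp.
have ltp : (p < n.+1.*2)%N by rewrite doubleS -mE.
move: np ltp; rewrite -(odd_double_half p); case: (odd p) => /=.
  rewrite add1n ltn_Sdouble => np lt.
  by have := H1 _ lt; rewrite np ltn0.
rewrite add0n ltn_double; case: (p./2) => // k np lt.
by have := H2 0%N k.+1; rewrite lt np ltn0 => /(_ isT).
Qed.

(** Induction on [n], stripping off the pair that contains 0. The condition on [e] covers Pfaffian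
    and Hafnian at once. *)
Lemma match_perm_msum e (T : Type) (f : T -> T -> K) d n m (s : seq T) :
  e ^+ 2 = 1 -> m = n.*2 -> size s = m ->
  \sum_(p : 'S_m | is_matching n p) e ^+ p *
     \prod_(k < n) f (nth d s (pnat p k.*2)) (nth d s (pnat p k.*2.+1)) = msum e f s.
Proof.
move=> e2; elim: n m s => [|n IHn] m s mE sz.
  case: m mE sz => //= _ /size0nil ->.
  rewrite (big_pred1 1%g) => [|p].
    by rewrite big_ord0 odd_perm1 mulr1.
  rewrite /= [RHS](_ : _ = true); last by apply/eqP/permP => -[].
  by apply/is_matchingP; split=> [k|k l] //; rewrite ltn0 andbF.
case: m mE sz => [|[|m]] //; rewrite doubleS => -[mE].
case: s => // x s [szs]; rewrite msum_cons.
rewrite (eq_bigl (fun p => is_matching n.+1 p && (p ord0 == ord0))); last first.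
  move=> p; case pM: (is_matching _ _) => //=.
  by rewrite (is_matching0 mE pM) eqxx.
rewrite (sum_lift_perm ord0 ord0).
(* Once the fixed point 0 is removed, the image of the next position is the index of the partner of
   0. *)
rewrite (partition_big (fun p : 'S_m.+1 => p ord0) xpredT) // szs.
apply: eq_bigr => j _; rewrite (sum_lift_perm ord0 j).
rewrite -(IHn m _ mE); last by rewrite size_del szs.
rewrite mulr_sumr; apply: eq_big => p; first by rewrite is_matching_lift.
move=> _; rewrite big_ord_recl /=.
rewrite (pnatE _ ord0) lift_perm_id /=.
rewrite pnat_lift // (pnatE _ ord0) lift_perm_id.
rewrite !odd_lift_perm /=.
(* The sign of a lifted permutation sees only the parity of [j], which suffices because
   [e ^+ 2 = 1]. *)
have -> : e ^+ (odd j (+) p)%R = e ^+ j * e ^+ p.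
  rewrite -[in RHS](odd_double_half j) -mul2n exprD exprM e2 expr1n mulr1.
  by case: (odd j) (odd_perm p) => [] [] //=; rewrite ?mulr1 ?mul1r //= -expr2 e2.
rewrite -!mulrA; congr (_ * _).
rewrite [in RHS]mulrCA; congr (_ * _).
rewrite add0n (set_nth_default x d) ?szs //.
congr (_ * _); apply: eq_bigr => k _.
have evk : (k.*2 < m)%N by rewrite mE ltn_double.
have odk : (k.*2.+1 < m)%N by rewrite mE ltn_Sdouble.
rewrite [bump 0 k]/bump leq0n add1n doubleS.
rewrite !(pnat_lift ord0) //.
rewrite !(pnat_lift j) //.
by rewrite !nth_del /bump.
Qed.

End Bridge.

Section PfHf.
Variables (K : fieldType) (n : nat) (n_gt0 : (0 < n)%N).

Lemma perfect_matchingE (s : 'S_(2 * n)) : perfect_matching s = is_matching n s.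
Proof.
have E1 (k : 'I_n) : s (ord_fst k) = pnat s k.*2 :> nat by rewrite -mul2n (pnatE s (ord_fst k)).
have E2 (k : 'I_n) : s (ord_snd k) = pnat s k.*2.+1 :> nat.
  by rewrite -mul2n (pnatE s (ord_snd k)).
congr (_ && _); first by apply: eq_forallb => k; rewrite E1 E2.
by apply: eq_forallb => k; apply: eq_forallb => l; rewrite !E1.
Qed.

Lemma match_sum_enum (e : K) (A : 'M[K]_(2 * n)) : e ^+ 2 = 1 ->
  \sum_(s : 'S_(2 * n) | perfect_matching s)
    e ^+ s * \prod_(k < n) A (s (ord_fst k)) (s (ord_snd k))
  = msum e (fun i j => A i j) (enum 'I_(2 * n)).
Proof.
move=> e2; have d : 'I_(2 * n) by exists 0%N; rewrite muln_gt0.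
rewrite -(match_perm_msum _ d e2 (mul2n n)) ?size_enum_ord //.
apply: eq_big => s; first exact: perfect_matchingE.
move=> _; congr (_ * _); apply: eq_bigr => k _.
have -> : k.*2 = ord_fst k by rewrite /= mul2n.
have -> : (ord_fst k).+1 = ord_snd k by [].
by rewrite !pnatE !nth_ord_enum.
Qed.

Lemma Pf_msum (A : 'M[K]_(2 * n)) :
  Pf A = msum (-1) (fun i j => A i j) (enum 'I_(2 * n)).
Proof. by rewrite -match_sum_enum // sqrrN expr1n. Qed.

Lemma Hf_msum (A : 'M[K]_(2 * n)) :
  Hf A = msum 1 (fun i j => A i j) (enum 'I_(2 * n)).
Proof.
rewrite -match_sum_enum ?expr1n //; apply: eq_bigr => s _.
by rewrite expr1n mul1r.
Qed.

End PfHf.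

(** * Products over pairs of list entries *)

Section PairProd.
Variable K : fieldType.

Fixpoint pairprod (T : Type) (g : T -> T -> K) (s : seq T) : K :=
  if s is x :: s' then \prod_(y <- s') g x y * pairprod g s' else 1.

Lemma pairprod_map (T U : Type) (g : U -> U -> K) (h : T -> U) s :
  pairprod g (map h s) = pairprod (fun x y => g (h x) (h y)) s.
Proof. by elim: s => //= x s ->; rewrite big_map. Qed.

Lemma pairprod_enum m (g : 'I_m -> 'I_m -> K) :
  pairprod g (enum 'I_m) = \prod_(i < m) \prod_(j < m | (i < j)%N) g i j.
Proof.
elim: m g => [|m IHm] g; first by rewrite big_ord0 enum_ord0.
rewrite enum_ordSl /= pairprod_map IHm big_ord_recl big_map big_enum /=.
congr (_ * _); first by rewrite [RHS]big_mkcond big_ord_recl /= mul1r.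
apply: eq_bigr => i _; rewrite [RHS]big_mkcond big_ord_recl /= mul1r -big_mkcond /=.
by apply: eq_bigl => j.
Qed.

Lemma eq_pairprod (T : eqType) (g h : T -> T -> K) s :
  uniq s -> {in s &, forall x y, x != y -> g x y = h x y} -> pairprod g s = pairprod h s.
Proof.
elim: s => //= x s IHs /andP[xs us] gh; rewrite IHs //; last first.
  by move=> y z ys zs; apply: gh; rewrite in_cons ?ys ?zs orbT.
congr (_ * _); rewrite !big_seq; apply: eq_bigr => y ys.
by apply: gh; rewrite ?mem_head // ?in_cons ?ys ?orbT //; apply: contraNneq xs => ->.
Qed.

Lemma pairprodM (T : Type) (g h : T -> T -> K) s :
  pairprod (fun x y => g x y * h x y) s = pairprod g s * pairprod h s.
Proof. by elim: s => [|x s IHs] /=; rewrite ?mul1r // IHs big_split /= mulrACA. Qed.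

Lemma pairprodV (T : Type) (g : T -> T -> K) s :
  pairprod (fun x y => (g x y)^-1) s = (pairprod g s)^-1.
Proof. by elim: s => [|x s IHs] /=; rewrite ?invr1 // IHs prodfV invfM. Qed.

Lemma pairprod_neq0 (T : eqType) (g : T -> T -> K) s :
  uniq s -> {in s &, forall x y, x != y -> g x y != 0} -> pairprod g s != 0.
Proof.
elim: s => [|x s IHs] /=; rewrite ?oner_neq0 // => /andP[xs us] g0.
rewrite mulf_neq0 //; last first.
  by apply: IHs => // y z ys zs; apply: g0; rewrite in_cons ?ys ?zs orbT.
rewrite prodf_seq_neq0; apply/allP => y ys /=.
by apply: g0; rewrite ?mem_head // ?in_cons ?ys ?orbT //; apply: contraNneq xs => ->.
Qed.

Lemma pairprod_mul (T : Type) (d : T -> K) s :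
  pairprod (fun x y => d x * d y) s = (\prod_(x <- s) d x) ^+ (size s).-1.
Proof.
elim: s => //= x s ->; rewrite big_cons big_split big_const_seq count_predT.
rewrite iter_mulr_1; case: s => [|y s] /=; first by rewrite big_nil !mulr1.
by rewrite exprMn -mulrA -exprS.
Qed.

(** Moving the entry at position [i] to the front reverses its [i] pairs with earlier entries, and
    each reversal costs a factor [e]. *)
Lemma pairprod_del (T : Type) (e : K) (g : T -> T -> K) d i s :
  (forall x y, g x y = e * g y x) -> (i < size s)%N ->
  pairprod g s = e ^+ i * \prod_(y <- del i s) g (nth d s i) y * pairprod g (del i s).
Proof.
move=> ge; elim: s i => // x s IHs [|i] /= lti; first by rewrite mul1r.
rewrite (IHs i lti) (big_del _ d lti) big_cons (ge x) exprS.
by ring.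
Qed.

End PairProd.

(** * Hafnians *)

Section Without.
Variable T : eqType.
Implicit Types (x y : T) (s : seq T).

(** Deletion by value, for use where the order is immaterial: on duplicate-free lists it agrees with
    [del], and two deletions commute. *)
Definition without y s := [seq x <- s | x != y].

Lemma without_id y s : y \notin s -> without y s = s.
Proof.
move=> ys; apply/all_filterP/allP => x xs.
by apply: contraNneq ys => <-.
Qed.

Lemma mem_without x y s : (x \in without y s) = (x != y) && (x \in s).
Proof. by rewrite mem_filter. Qed.

Lemma without_uniq y s : uniq s -> uniq (without y s).
Proof. exact: filter_uniq. Qed.

Lemma withoutC x y s : without x (without y s) = without y (without x s).
Proof. by rewrite /without -!filter_predI; apply: eq_filter => z /=; rewrite andbC. Qed.

Lemma perm_without y s : uniq s -> y \in s -> perm_eq s (y :: without y s).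
Proof.
move=> us ys; apply: uniq_perm => //=; first by rewrite without_uniq // mem_without eqxx.
move=> x; rewrite in_cons mem_without.
by case: (eqVneq x y) => [->|].
Qed.

Lemma perm_without2 y s t : perm_eq s t -> perm_eq (without y s) (without y t).
Proof. by move=> st; apply: perm_filter. Qed.

Lemma size_without y s : uniq s -> y \in s -> size (without y s) = (size s).-1.
Proof. by move=> us ys; rewrite (perm_size (perm_without us ys)). Qed.

Lemma big_without (R : Type) (idx : R) (op : R -> R -> R) y s (F : T -> R) :
  \big[op/idx]_(x <- without y s) F x = \big[op/idx]_(x <- s | x != y) F x.
Proof. by rewrite big_filter. Qed.

Lemma prod_without (K : comPzRingType) y s (F : T -> K) : uniq s -> y \in s ->
  \prod_(x <- s) F x = F y * \prod_(x <- without y s) F x.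
Proof. by move=> us ys; rewrite (perm_big _ (perm_without us ys)) big_cons. Qed.

Lemma sum_del (K : fieldType) (F : T -> seq T -> K) d s : uniq s ->
  \sum_(i < size s) F (nth d s i) (del i s) = \sum_(y <- s) F y (without y s).
Proof.
move=> us; rewrite [RHS](big_nth d) big_mkord; apply: eq_bigr => i _.
by rewrite (del_filter d us).
Qed.

End Without.

Section HafnianPerm.
Variables (K : fieldType) (T : eqType) (g : T -> T -> K).
Hypothesis g_sym : forall x y, g x y = g y x.
Local Notation hf := (msum 1 g).

Lemma hf_cons x s : uniq s ->
  hf (x :: s) = \sum_(y <- s) g x y * hf (without y s).
Proof.
move=> us; rewrite -(sum_del (fun y t => g x y * hf t) x us) msum_cons.
by apply: eq_bigr => i _; rewrite expr1n mul1r.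
Qed.

(** Either [x] and [y] are matched together, or they have partners [c] and [d]; exchanging the two
    summations interchanges the partners. *)
Lemma hf_swap x y s : uniq (x :: y :: s) -> hf (x :: y :: s) = hf (y :: x :: s).
Proof.
rewrite /= in_cons negb_or => /and3P[/andP[xy xs] ys us].
have expand a b : a != b -> a \notin s -> b \notin s ->
    hf (a :: b :: s) = g a b * hf s +
      \sum_(c <- s) \sum_(d <- s | d != c) g a c * g b d * hf (without d (without c s)).
  move=> ab as_ bs; rewrite hf_cons /= ?bs // big_cons /= eqxx /= -/(without b s) without_id //.
  congr (_ + _); rewrite big_seq [RHS]big_seq; apply: eq_bigr => c cs.
  rewrite /without /= ifT; last by apply: contraNneq bs => ->.
  rewrite -/(without c s) hf_cons ?without_uniq // big_without mulr_sumr.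
  by apply: eq_bigr => d _; rewrite mulrA.
rewrite !expand // 1?eq_sym //.
rewrite g_sym; congr (_ + _).
under eq_bigr => c _ do rewrite big_mkcond.
rewrite exchange_big /=; apply: eq_bigr => c _.
rewrite [RHS]big_mkcond; apply: eq_bigr => d _.
by rewrite eq_sym withoutC (mulrC (g x d)).
Qed.

(** Induction on the size. Equal heads are handled by expansion; if the heads differ, the head of
    [t] is brought to second place in [s] and swapped to the front. *)
Lemma hf_perm s t : uniq s -> perm_eq s t -> hf s = hf t.
Proof.
move: {2}(size s) (leqnn (size s)) => k.
elim/ltn_ind: k s t => k IHk s t lesk us st.
have ut : uniq t by rewrite -(perm_uniq st).
have szt := perm_size st.
case: s us lesk st szt => [|x s] us lesk st szt.
  by case: t st ut szt.
have congr_cons y s' t' : (size s' < k)%N -> uniq s' -> perm_eq s' t' ->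
    hf (y :: s') = hf (y :: t').
  move=> szs us' st'; rewrite !hf_cons -?(perm_uniq st') // (perm_big _ st') /=.
  rewrite big_seq [RHS]big_seq; apply: eq_bigr => z zt; congr (_ * _).
  have zs : z \in s' by rewrite (perm_mem st').
  apply: (IHk (size (without z s'))) => //; last exact: perm_without2.
    by rewrite size_without // (leq_ltn_trans (leq_pred _)).
  exact: without_uniq.
case: t st ut szt => [|y t] // st ut szt.
have [xy|xy] := eqVneq x y.
  rewrite -xy in st *; apply: congr_cons => //; first by case/andP: us.
  by rewrite perm_cons in st.
have [/andP[xs us'] /andP[yt ut']] := (us, ut).
have ys : y \in s.
  by have := perm_mem st y; rewrite !in_cons eqxx (eq_sym y) (negPf xy).
have ps := perm_without us' ys.
have uxy : uniq [:: x, y & without y s].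
  by rewrite -(perm_uniq (_ : perm_eq (x :: s) _)) // perm_cons.
rewrite (congr_cons x _ _ lesk us' ps) hf_swap //.
apply: congr_cons.
- by move: (perm_size ps) lesk => /= <-.
- by move: uxy => /= /and3P[]; rewrite in_cons negb_or => /andP[_ ->] _ ->.
- rewrite -(perm_cons y); apply: perm_trans st; rewrite perm_sym.
  have : perm_eq (x :: s) [:: x, y & without y s] by rewrite perm_cons.
  move=> /perm_trans; apply.
  by rewrite -(cat1s x) -(cat1s y) perm_catCA.
Qed.

Lemma hf_expand x s : uniq s -> x \in s ->
  hf s = \sum_(y <- without x s) g x y * hf (without y (without x s)).
Proof.
move=> us xs; rewrite (hf_perm us (perm_without us xs)) hf_cons //.
exact: without_uniq.
Qed.

End HafnianPerm.

Section HafnianDifferences.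
Variable K : fieldType.
Local Notation g := (fun x y : K => (1 + x * y)^-1).
Local Notation hf := (msum 1 g).

(** Expand [hf (without m s)] along [l] and [hf (without l s)] along [m]. The coefficients differ by
    [k (m - l) / ((1 + l k) (1 + m k))], which cancels the denominator; exchanging [l] and [k] then
    lets the sum be reassembled into [hf (without m s)]. *)
Lemma hf_differences (s : seq K) m : uniq s -> m \in s ->
  {in s &, forall x y, x != y -> 1 + x * y != 0} ->
  \sum_(l <- without m s) (hf (without m s) - hf (without l s)) / (m - l) =
  hf (without m s) * \sum_(l <- without m s) l / (1 + l * m).
Proof.
move=> us ms s0; set r := without m s.
have ur : uniq r by apply: without_uniq.
have gC x y : g x y = g y x by rewrite mulrC.
have mr : m \notin r by rewrite mem_without eqxx.
have rs x : x \in r -> x \in s by rewrite mem_without => /andP[].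
have nm x : x \in r -> m != x by move=> xr; apply: contraNneq mr => ->.
pose h l k := hf (without k (without l r)).
have hC l k : h l k = h k l by rewrite /h withoutC.
have hm l : l \in r -> hf r = \sum_(k <- r | k != l) g l k * h l k.
  by move=> lr; rewrite (hf_expand gC ur lr) big_without.
have hl l : l \in r -> hf (without l s) = \sum_(k <- r | k != l) g m k * h l k.
  move=> lr; have ml : m \in without l s by rewrite mem_without nm.
  rewrite (hf_expand gC (without_uniq _ us) ml) withoutC -/r.
  by rewrite big_without.
transitivity (\sum_(l <- r) \sum_(k <- r | k != l) k * (g l k * g m k * h l k)).
  rewrite big_seq [RHS]big_seq; apply: eq_bigr => l lr.
  rewrite (hm l lr) (hl l lr) -sumrB mulr_suml big_seq_cond [RHS]big_seq_cond.
  apply: eq_bigr => k /andP[kr kl].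
  have d0 : m - l != 0 by rewrite subr_eq0 nm.
  have a0 : 1 + l * k != 0 by rewrite s0 ?rs // eq_sym.
  have b0 : 1 + m * k != 0 by apply: s0 => //; [apply: rs | apply: nm].
  by field; rewrite b0 a0 d0.
under eq_bigr => l _ do rewrite big_mkcond.
rewrite exchange_big mulr_sumr /=.
rewrite big_seq [RHS]big_seq; apply: eq_bigr => l lr.
rewrite (hm l lr) mulr_suml [RHS]big_mkcond; apply: eq_bigr => k _.
rewrite eq_sym; case: ifP => // _.
by rewrite hC (mulrC k l) (mulrC m l); ring.
Qed.

End HafnianDifferences.

(** * The Pfaffian-Hafnian identity *)

Section PolyFacts.
Variable K : fieldType.
Implicit Types (p q : {poly K}) (rs : seq K).

Lemma double_roots_eq0 p rs : uniq rs ->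
  {in rs, forall r, p.[r] = 0 /\ p^`().[r] = 0} ->
  (size p <= (size rs).*2)%N -> p = 0.
Proof.
elim: rs p => [|r rs IHrs] p /=; first by move=> _ _; rewrite size_poly_leq0 => /eqP.
move=> /andP[rrs urs] pr szp.
have [/eqP/factor_theorem[q pq] p'r] := pr r (mem_head _ _).
have : q.[r] = 0.
  by move: p'r; rewrite pq derivM !derivE !hornerE subrr mulr0 add0r.
move=> /eqP/factor_theorem[q2 qq2].
rewrite qq2 in pq.
suff q20 : q2 = 0 by rewrite pq q20 !mul0r.
apply: IHrs => // [t trs|].
  have tr : t - r != 0 by rewrite subr_eq0; apply: contraNneq rrs => <-.
  have [] := pr t _; first by rewrite in_cons trs orbT.
  rewrite pq !derivM !derivE !hornerE => /eqP.
  rewrite !mulf_eq0 !(negPf tr) !orbF => /eqP q2t.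
  rewrite q2t !mul0r !addr0 => /eqP.
  by rewrite !mulf_eq0 !(negPf tr) !orbF => /eqP q2't; split.
have [->|q20] := eqVneq q2 0; first by rewrite size_poly0.
move: szp; rewrite pq -mulrA -expr2 size_Mmonic ?monic_exp ?monicXsubC //.
by rewrite size_exp_XsubC addn3 doubleS !ltnS.
Qed.

Lemma size_prod_linear (T : Type) (F : T -> {poly K}) (s : seq T) :
  (forall x, (size (F x) <= 2)%N) -> (size (\prod_(x <- s) F x)%R <= (size s).+1)%N.
Proof.
move=> F2; elim: s => [|x s IHs]; first by rewrite big_nil size_poly1.
rewrite big_cons (leq_trans (size_polyMleq _ _)) //=.
rewrite -subn1 leq_subLR.
exact: leq_trans (leq_add (F2 x) IHs) _.
Qed.

Lemma size_sum_leq (T : eqType) (F : T -> {poly K}) (s : seq T) k :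
  {in s, forall x, (size (F x) <= k)%N} -> (size (\sum_(x <- s) F x)%R <= k)%N.
Proof.
elim: s => [|x s IHs] Fk; first by rewrite big_nil size_poly0.
rewrite big_cons (leq_trans (size_polyD _ _)) // geq_max Fk ?mem_head //=.
by apply: IHs => y ys; rewrite Fk // in_cons ys orbT.
Qed.

(** The logarithmic derivative of a product. *)
Lemma deriv_prod_horner (T : eqType) (F : T -> {poly K}) (s : seq T) w :
  {in s, forall x, (F x).[w] != 0} ->
  (\prod_(x <- s) F x)^`().[w] =
    (\prod_(x <- s) (F x).[w]) * \sum_(x <- s) (F x)^`().[w] / (F x).[w].
Proof.
elim: s => [|x s IHs] F0; first by rewrite !big_nil derivE hornerE mulr0.
have Fx : (F x).[w] != 0 by rewrite F0 ?mem_head.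
rewrite !big_cons derivM !hornerE IHs; last first.
  by move=> y ys; rewrite F0 // in_cons ys orbT.
by rewrite horner_prod; field.
Qed.

End PolyFacts.

Section PfaffianHafnian.
Variable K : fieldType.
Local Notation hf := (msum 1 (fun x y : K => (1 + x * y)^-1)).
Local Notation L := (fun x : K => 1 + x%:P * 'X : {poly K}).
Local Notation D := (fun x : K => x%:P - 'X : {poly K}).

Lemma size_L x : (size (L x) <= 2)%N.
Proof.
rewrite (leq_trans (size_polyD _ _)) // geq_max size_poly1 /=.
by rewrite (leq_trans (size_polyMleq _ _)) // size_polyX; case: size (size_polyC_leq1 x) => [|[]].
Qed.

Lemma size_D x : (size (D x) <= 2)%N.
Proof. by rewrite /= -opprB size_polyN size_XsubC. Qed.

(** The induction step of the Pfaffian-Hafnian identity with denominators cleared and the first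
    variable as ['X]. Both sides have degree below [2 * size s] and agree to second order at each
    [- x^-1], the zero of [L x]. *)
Lemma hafnian_interpolation_poly (s : seq K) : uniq s ->
  {in s, forall x, x != 0} ->
  {in s &, forall x y, x != y -> 1 + x * y != 0} ->
  \sum_(y <- s) (hf (without y s) *
     \prod_(t <- without y s) ((1 + y * t) / (y - t)))%:P *
       (D y * (\prod_(t <- without y s) L t) ^+ 2) =
  \prod_(y <- s) D y *
    \sum_(y <- s) (hf (without y s))%:P * \prod_(t <- without y s) L t.
Proof.
move=> us s_neq0 s_adm; apply/eqP; rewrite -subr_eq0; apply/eqP.
pose rs := [seq - x^-1 | x <- s].
apply: (@double_roots_eq0 _ _ rs).
- by rewrite map_inj_uniq // => x y /oppr_inj/invr_inj.
- move=> _ /mapP[m ms ->]; set w := - m^-1.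
  have m0 := s_neq0 m ms.
  set r := without m s.
  have ur : uniq r by apply: without_uniq.
  have rs_mem x : x \in r -> x \in s by rewrite mem_without => /andP[].
  have nm x : x \in r -> m - x != 0.
    by rewrite mem_without subr_eq0 eq_sym => /andP[].
  have am x : x \in r -> 1 + m * x != 0.
    move=> xr; apply: s_adm => //; first exact: rs_mem.
    by rewrite -subr_eq0 nm.
  have Lsplit y : y \in r ->
      \prod_(t <- without y s) L t = L m * \prod_(t <- without y r) L t.
    move=> yr; rewrite /r withoutC -(prod_without L) ?without_uniq //.
    by rewrite mem_without ms andbT -subr_eq0 nm.
  rewrite (perm_big _ (perm_without us ms)) big_cons -/r.
  rewrite (prod_without D us ms) -/r.
  rewrite [X in _ * _ * X](perm_big _ (perm_without us ms)) big_cons -/r /=.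
  set H := hf r; set c := \prod_(_ <- _) (_ / _).
  set Pi := \prod_(t <- r) L t; set G := \prod_(t <- r) D t.
  (* On the left, the terms with [y] other than [m] contain [L m ^+ 2] and vanish to second order at
     [w]. *)
  have [R ->] : exists R, \sum_(y <- r) (hf (without y s) *
      \prod_(t <- without y s) ((1 + y * t) / (y - t)))%:P *
        (D y * (\prod_(t <- without y s) L t) ^+ 2) = L m ^+ 2 * R.
    exists (\sum_(y <- r) (hf (without y s) *
      \prod_(t <- without y s) ((1 + y * t) / (y - t)))%:P *
        (D y * (\prod_(t <- without y r) L t) ^+ 2)).
    rewrite mulr_sumr big_seq [RHS]big_seq; apply: eq_bigr => y yr.
    by rewrite (Lsplit y yr); ring.
  (* On the right, these terms contain [L m] only once, so [S] enters the derivative at [w]. *)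
  pose S := \sum_(y <- r) (hf (without y s))%:P * \prod_(t <- without y r) L t.
  have -> : \sum_(y <- r) (hf (without y s))%:P * \prod_(t <- without y s) L t = L m * S.
    rewrite mulr_sumr big_seq [RHS]big_seq; apply: eq_bigr => y yr.
    by rewrite (Lsplit y yr); ring.
  have Lw t : (L t).[w] = (m - t) / m by rewrite !hornerE /w; field.
  have Dw t : (D t).[w] = (1 + m * t) / m by rewrite !hornerE /w; field.
  have Lmw : (L m).[w] = 0 by rewrite Lw subrr mul0r.
  have Lw0 t : t \in r -> (L t).[w] != 0.
    by move=> tr; rewrite Lw mulf_neq0 ?invr_eq0 ?nm.
  have Dw0 t : t \in r -> (D t).[w] != 0.
    by move=> tr; rewrite Dw mulf_neq0 ?invr_eq0 ?am.
  have Gw : G.[w] = c * Pi.[w].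
    rewrite !horner_prod /c -big_split /= big_seq [RHS]big_seq.
    apply: eq_bigr => t tr; rewrite Lw Dw; field.
    by rewrite m0 nm.
  have Piw : Pi^`().[w] = Pi.[w] * \sum_(t <- r) (t * m) / (m - t).
    rewrite deriv_prod_horner // -horner_prod; congr (_ * _).
    rewrite big_seq [RHS]big_seq; apply: eq_bigr => t tr.
    by rewrite Lw !derivE !hornerE; field; rewrite m0 nm.
  have G'w : G^`().[w] = G.[w] * \sum_(t <- r) - m / (1 + t * m).
    rewrite deriv_prod_horner // -horner_prod; congr (_ * _).
    rewrite big_seq [RHS]big_seq; apply: eq_bigr => t tr.
    by rewrite Dw !derivE !hornerE (mulrC t); field; rewrite m0 am.
  have Sw : S.[w] = Pi.[w] * (m * \sum_(t <- r) hf (without t s) / (m - t)).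
    rewrite horner_sum !mulr_sumr big_seq [RHS]big_seq; apply: eq_bigr => t tr.
    rewrite !hornerE /Pi (prod_without L ur tr) hornerM Lw.
    by rewrite /=; field; rewrite m0 nm.
  (* Equality of the derivatives at [w] amounts to this: [H] times the difference of the logarithmic
     derivatives of [Pi] and [G] balances the contribution of [S]. *)
  have key : H * (\sum_(t <- r) (t * m) / (m - t) - \sum_(t <- r) - m / (1 + t * m)) =
      m * (m * \sum_(t <- r) hf (without t s) / (m - t)).
    have := hf_differences us ms s_adm; rewrite -/r -/H => hd.
    have -> : \sum_(t <- r) hf (without t s) / (m - t) =
        H * (\sum_(t <- r) (m - t)^-1 - \sum_(t <- r) t / (1 + t * m)).
      rewrite mulrBr -hd mulr_sumr -sumrB; apply: eq_bigr => t _.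
      by ring.
    rewrite mulrCA [m * (H * _)]mulrCA -!sumrB !mulr_sumr.
    rewrite big_seq [RHS]big_seq; apply: eq_bigr => t tr; field.
    by rewrite nm // mulrC am.
  have Dmw : (D m)^`().[w] = -1 by rewrite !derivE !hornerE.
  have Lm'w : (L m)^`().[w] = m by rewrite !derivE !hornerE.
  move: Lmw Dmw Lm'w; rewrite /=; move: (L m) (D m) => Lm Dm Lmw Dmw Lm'w.
  split.
    rewrite !hornerE Lmw Gw /=; ring.
  rewrite !(derivE, derivM, hornerE) Lmw Dmw Lm'w Piw G'w Gw Sw.
  set A1 := \sum_(_ <- _) _ in key *; set B1 := \sum_(_ <- _) _ in key *.
  set U := m * \sum_(_ <- _) _ in key *.
  transitivity (c * Pi.[w] ^+ 2 * Dm.[w] * (H * (A1 - B1) - m * U)).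
    by rewrite /=; ring.
  by rewrite key subrr mulr0.
- have szL y : y \in s -> (size (\prod_(t <- without y s) L t)%R <= size s)%N.
    move=> ys; rewrite (leq_trans (size_prod_linear _ size_L)) //.
    by rewrite size_without // prednK //; case: (s) ys.
  rewrite size_map (leq_trans (size_polyD _ _)) // geq_max size_polyN.
  apply/andP; split.
    apply: size_sum_leq => y ys; rewrite mul_polyC (leq_trans (size_scale_leq _ _)) //.
    have s0 : (0 < size s)%N by case: (s) ys.
    set p := \prod_(_ <- _) _.
    have szp2 : (size (p ^+ 2) <= (size s + size s).-1)%N.
      have := szL y ys; have := size_polyMleq p p; rewrite -/p -expr2.
      move: (size p) (size (p ^+ 2)) => a b; lia.
    apply: leq_trans (size_polyMleq _ _) _; rewrite -addnn /=.
    have := size_D y; move: szp2 s0 => /=.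
    move: (size (p ^+ 2)) (size (y%:P - 'X)) (size s) => a b c; lia.
  set Q := \sum_(_ <- _) _.
  have szQ : (size Q <= size s)%N.
    apply: size_sum_leq => y ys; rewrite mul_polyC (leq_trans (size_scale_leq _ _)) //.
    exact: szL.
  set P := \prod_(_ <- _) _.
  have szP : (size P <= (size s).+1)%N by apply: size_prod_linear size_D.
  apply: leq_trans (size_polyMleq _ _) _; rewrite -addnn.
  move: szP szQ; move: (size Q) (size P) (size s) => a b c; lia.
Qed.


(** Expansion along the first entry [z] and induction leave an identity in [z]; multiplied by
    [Pi ^+ 2], it is [hafnian_interpolation_poly] evaluated at [z]. *)
Theorem pfaffian_hafnian (s : seq K) : ~~ odd (size s) -> uniq s ->
  {in s, forall x, x != 0} ->
  {in s &, forall x y, x != y -> 1 + x * y != 0} ->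
  msum (-1) (fun x y => (y - x) / (1 + x * y) ^+ 2) s =
  pairprod (fun x y => (y - x) / (1 + x * y)) s * hf s.
Proof.
elim/msum_ind: s => [|z s IH]; first by rewrite mul1r.
rewrite /= negbK => odds /andP[zs us] s_neq0 s_adm.
set f := fun x y => _ / _ ^+ 2; set g := fun x y : K => _ / _.
have s'_neq0 : {in s, forall x, x != 0}.
  by move=> x xs; rewrite s_neq0 // in_cons xs orbT.
have s'_adm : {in s &, forall x y, x != y -> 1 + x * y != 0}.
  by move=> x y xs ys; apply: s_adm; rewrite in_cons ?xs ?ys orbT.
have z_adm y : y \in s -> 1 + y * z != 0.
  move=> ys; apply: s_adm; rewrite ?mem_head // ?in_cons ?ys ?orbT //.
  by apply: contraNneq zs => <-.
have g_anti x y : g x y = -1 * g y x.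
  by rewrite /g (mulrC y x) mulN1r -mulNr opprB.
have g_neq0 : {in s &, forall x y, x != y -> g x y != 0}.
  move=> x y xs ys xy; rewrite /g mulf_neq0 ?invr_eq0 ?s'_adm //.
  by rewrite subr_eq0 eq_sym.
rewrite msum_cons hf_cons //.
(* The sign [(-1) ^+ i] of the expansion cancels the one from bringing entry [i] to the front in
   [pairprod g s]. *)
transitivity (\sum_(i < size s) f z (nth z s i) * pairprod g s * hf (del i s) /
                \prod_(t <- del i s) g (nth z s i) t).
  apply: eq_bigr => i _.
  have E := del_filter z us (ltn_ord i).
  have memd x : x \in del i s -> x \in s by rewrite E mem_filter => /andP[].
  rewrite IH //; last first.
  - by move=> x y xs ys; apply: s'_adm; apply: memd.
  - by move=> x xs; apply/s'_neq0/memd.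
  - by rewrite E filter_uniq.
  - by rewrite (size_del (ltn_ord i)); case: (size s) odds => //= k; rewrite negbK.
  rewrite -/f -/g (pairprod_del z g_anti (ltn_ord i)).
  set P := \prod_(_ <- _) _.
  have P0 : P != 0.
    rewrite prodf_seq_neq0; apply/allP => t td /=.
    apply: g_neq0; rewrite ?mem_nth ?memd //.
    by move: td; rewrite E mem_filter eq_sym => /andP[].
  by field.
rewrite (sum_del (fun y t => f z y * pairprod g s * hf t / \prod_(x <- t) g y x) z us).
have := congr1 (fun p => p.[z]) (hafnian_interpolation_poly us s'_neq0 s'_adm).
rewrite /= hornerM !horner_sum horner_prod => interp.
set Pi := \prod_(y <- s) (1 + y * z).
have Pi0 : Pi != 0.
  by rewrite prodf_seq_neq0; apply/allP => t td; rewrite z_adm.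
have Pi_split y : y \in s ->
    (\prod_(t <- without y s) (1 + t%:P * 'X)).[z] = Pi / (1 + y * z).
  move=> ys; rewrite /Pi (prod_without (fun y => 1 + y * z) us ys) horner_prod.
  rewrite mulrC mulKf ?z_adm //.
  by apply: eq_bigr => t _; rewrite !hornerE.
have Dz : \prod_(y <- s) (y%:P - 'X).[z] = (\prod_(y <- s) g z y) * Pi.
  rewrite -big_split /= big_seq [RHS]big_seq; apply: eq_bigr => y ys.
  by rewrite !hornerE /g (mulrC z) divfK ?z_adm.
apply: (mulIf (expf_neq0 2 Pi0)).
transitivity (pairprod g s * (\prod_(y <- s) g z y * Pi *
   \sum_(y <- s) hf (without y s) * (Pi / (1 + y * z)))); last first.
  rewrite [in RHS]mulr_sumr !mulr_suml !mulr_sumr.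
  by apply: eq_bigr => y _; rewrite (mulrC z y) /=; ring.
have -> : \sum_(y <- s) hf (without y s) * (Pi / (1 + y * z)) =
    \sum_(y <- s) ((hf (without y s))%:P * \prod_(t <- without y s) L t).[z].
  rewrite big_seq [RHS]big_seq; apply: eq_bigr => y ys.
  by rewrite hornerM hornerC Pi_split.
rewrite -Dz -interp mulr_suml mulr_sumr big_seq [RHS]big_seq.
apply: eq_bigr => y ys.
rewrite hornerM hornerC hornerM horner_exp Pi_split // !hornerE.
have -> : \prod_(t <- without y s) ((1 + y * t) / (y - t)) =
    (\prod_(t <- without y s) g y t)^-1.
  (* [size s] is odd here, so [without y s] has even size and reversing all differences [y - t]
     costs no sign. *)
  rewrite -prodfV [LHS](_ : _ = \prod_(t <- without y s) (- 1 * (g y t)^-1)).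
    rewrite big_split big_const_seq count_predT iter_mulr_1 size_without //=.
    by rewrite -signr_odd; case: (size s) odds => //= k /negPf ->; rewrite mul1r.
  apply: eq_bigr => t _; rewrite /g invf_div mulN1r -mulrN -invrN opprB.
  by rewrite mulrC.
rewrite /f (mulrC z y); set P := (\prod_(_ <- _) _)^-1.
by rewrite /=; field; rewrite z_adm.
Qed.

End PfaffianHafnian.

(** * A Cauchy-type Pfaffian *)

Section PolyBasis.
Variable K : fieldType.
Implicit Types (phi : nat -> K) (p q : {poly K}).

(** The linear functional sending ['X^l] to [phi l]; a polynomial thereby records a linear
    combination of the values [phi l]. *)
Definition umbral phi p : K := \sum_(l < size p) p`_l * phi l.

Lemma umbralE phi p k : (size p <= k)%N ->
  umbral phi p = \sum_(l < k) p`_l * phi l.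
Proof.
move=> szp; rewrite /umbral (big_ord_widen k (fun l => p`_l * phi l) szp) big_mkcond.
apply: eq_bigr => l _; case: ltnP => // le_l.
by rewrite nth_default // mul0r.
Qed.

Lemma umbralD phi p q : umbral phi (p + q) = umbral phi p + umbral phi q.
Proof.
pose k := maxn (size p) (size q).
rewrite (@umbralE _ _ k) ?size_polyD // (@umbralE _ p k) ?leq_maxl //.
rewrite (@umbralE _ q k) ?leq_maxr // -big_split.
by apply: eq_bigr => l _; rewrite coefD mulrDl.
Qed.

Lemma umbralZ phi c p : umbral phi (c *: p) = c * umbral phi p.
Proof.
rewrite (@umbralE _ _ (size p)) ?size_scale_leq // mulr_sumr.
by apply: eq_bigr => l _; rewrite coefZ mulrA.
Qed.

Lemma umbralB phi p q : umbral phi (p - q) = umbral phi p - umbral phi q.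
Proof. by rewrite -scaleN1r umbralD umbralZ mulN1r. Qed.

Lemma umbralXn phi k : umbral phi 'X^k = phi k.
Proof.
rewrite /umbral size_polyXn big_ord_recr big1 /= => [|l _].
  by rewrite coefXn eqxx mul1r add0r.
by rewrite coefXn ltn_eqF // mul0r.
Qed.

Lemma umbral_mulXn phi k p : umbral phi ('X^k * p) = umbral (fun l => phi (k + l)%N) p.
Proof.
rewrite (@umbralE _ _ (k + size p)).
  rewrite big_split_ord /= big1 ?add0r => [|l _]; last first.
    by rewrite coefXnM ltn_ord mul0r.
  by apply: eq_bigr => l _; rewrite coefXnM ltnNge leq_addr /= addKn.
by rewrite (leq_trans (size_polyMleq _ _)) // size_polyXn addSn.
Qed.

Lemma umbral_scale phi c p : umbral (fun l => c * phi l) p = c * umbral phi p.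
Proof. by rewrite mulr_sumr; apply: eq_bigr => l _; rewrite mulrCA. Qed.

Lemma umbral_exp (x : K) p : umbral (fun l => x ^+ l) p = p.[x].
Proof. by rewrite horner_coef. Qed.

(* Replacing the monomials by monic polynomials of the same degrees is a
   unitriangular change of columns. *)
Lemma det_umbral m (phi : 'I_m -> nat -> K) (P : nat -> {poly K}) :
  (forall j, P j \is monic) -> (forall j, size (P j) = j.+1) ->
  \det (\matrix_(i < m, j < m) umbral (phi i) (P j)) =
  \det (\matrix_(i < m, j < m) phi i j).
Proof.
move=> P_monic szP; pose C : 'M[K]_m := \matrix_(j < m, l < m) (P j)`_l.
have C_trig : is_trig_mx C.
  apply/is_trig_mxP => i j ij; rewrite mxE nth_default // szP //.
have detC : \det C = 1.
  rewrite det_trig // big1 // => i _; rewrite mxE.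
  by have /monicP := P_monic i; rewrite lead_coefE szP.
rewrite -[RHS]mulr1 -detC -(det_tr C) -det_mulmx; congr (\det _).
apply/matrixP => i j; rewrite !mxE (@umbralE _ _ m) ?szP //.
by apply: eq_bigr => l _; rewrite !mxE mulrC.
Qed.

End PolyBasis.

Section CauchyPfaffian.
Variable K : fieldType.
Implicit Types (p q : K * K) (s : seq (K * K)).

(** Its invariance under inversion makes two points collide when the second coordinate of one is the
    inverse of the other's. *)
Definition recip (b : K) : K := b + b^-1.

(** With alpha = [p.1] and u = [recip p.2], this lists 1, alpha, u, alpha u, u^2, and so on. *)
Definition alt_monomial p (j : nat) : K := p.1 ^+ odd j * recip p.2 ^+ j./2.

Definition alt_mx m s : 'M[K]_m :=
  \matrix_(i < m, j < m) alt_monomial (nth (0, 0) s i) j.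

(* After subtracting [recip q.2] times each column from the one two places to its
   right, the rows of [p] and [q] are supported on the first two columns. *)
Lemma det_alt_mx_collision m p s (k : 'I_m.+1) :
  size s = m.+1 -> let q := nth (0, 0) s k in recip p.2 = recip q.2 ->
  \det (alt_mx m.+2 (p :: s)) =
    (-1) ^+ k * (q.1 - p.1) *
      (\prod_(t <- del k s) (recip t.2 - recip q.2)) * \det (alt_mx m (del k s)).
Proof.
move=> szs q upq; pose P j : {poly K} :=
  if j is j'.+2 then 'X^(j'.+2) - recip q.2 *: 'X^j' else 'X^j.
have szP j : size (P j) = j.+1.
  case: j => [|[|j]]; rewrite /P ?size_polyXn // size_polyDl ?size_polyXn //.
  by rewrite size_polyN (leq_ltn_trans (size_scale_leq _ _)) // size_polyXn.
have P_monic j : P j \is monic.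
  rewrite monicE lead_coefE szP /=; case: j => [|[|j]]; rewrite /P ?coefXn //.
  by rewrite coefB coefZ !coefXn eqxx (gtn_eqF (ltnW (ltnSn _))) mulr0 subr0.
pose row_pt (i : 'I_m.+2) := nth (0, 0) (p :: s) i.
rewrite -[LHS](det_umbral (fun i => alt_monomial (row_pt i)) P_monic szP).
set W := \matrix_(_, _) _.
have W0 i : W i ord0 = 1 by rewrite mxE umbralXn /alt_monomial !mulr1.
have W1 i : W i (lift ord0 ord0) = (row_pt i).1.
  by rewrite mxE umbralXn /alt_monomial mulr1.
have W2 i (j : 'I_m) : W i (lift ord0 (lift ord0 j)) =
    (recip (row_pt i).2 - recip q.2) * alt_monomial (row_pt i) j.
  rewrite mxE umbralB umbralZ !umbralXn /= /alt_monomial /= negbK exprS.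
  by ring.
have Wk : row_pt (lift ord0 k) = q by [].
(* The minor without the rows of [p] and [q] and without the first two columns. *)
pose R : 'M[K]_m := row' k (col' ord0 (row' ord0 (col' ord0 W))).
have detR : \det R = (\prod_(t <- del k s) (recip t.2 - recip q.2)) * \det (alt_mx m (del k s)).
  have szd : size (del k s) = m by rewrite size_del szs.
  pose d : 'rV[K]_m := \row_i (recip (nth (0, 0) (del k s) i).2 - recip q.2).
  have -> : R = diag_mx d *m alt_mx m (del k s).
    apply/matrixP => i j; rewrite mul_diag_mx /R; do 4 rewrite mxE; rewrite W2 !mxE.
    by rewrite nth_del.
  rewrite det_mulmx det_diag; congr (_ * _).
  rewrite (big_nth (0, 0)) szd big_mkord; apply: eq_bigr => i _.
  by rewrite mxE.
have cof0 : cofactor W ord0 ord0 = (-1) ^+ k * (q.1 * \det R).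
  rewrite /cofactor /= mul1r (expand_det_row _ k) big_ord_recl big1 => [|j _].
    rewrite addr0 /cofactor addn0 mulrCA; congr (_ * _).
    by do 2 rewrite mxE; rewrite W1.
  do 2 rewrite mxE.
  by rewrite W2 Wk subrr !mul0r.
have lift10 : lift (lift ord0 ord0) ord0 = ord0 :> 'I_m.+2 by apply: val_inj.
have lift1S (j : 'I_m) : lift (lift ord0 ord0) (lift ord0 j) = lift ord0 (lift ord0 j) :> 'I_m.+2.
  by apply: val_inj.
have cof1 : cofactor W ord0 (lift ord0 ord0) = - ((-1) ^+ k * \det R).
  rewrite /cofactor /= expr1 mulN1r; congr (- _).
  rewrite (expand_det_row _ k) big_ord_recl big1 => [|j _].
    do 2 rewrite mxE; rewrite lift10 W0 mul1r addr0 /cofactor addn0; congr (_ * \det _).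
    by apply/matrixP => i j; rewrite /R; do 4 rewrite [LHS]mxE; do 4 rewrite [RHS]mxE; rewrite lift1S.
  by do 2 rewrite mxE; rewrite lift1S W2 Wk subrr !mul0r.
rewrite (expand_det_row _ ord0) !big_ord_recl big1 => [|j _].
  by rewrite W0 W1 cof0 cof1 detR /row_pt /=; ring.
by rewrite W2 /row_pt /= upq subrr !mul0r.
Qed.

(** These cofactors serve as fixed coefficients while the second coordinate of the head varies. *)
Lemma cofactor_head m p q s (j : 'I_m.+1) :
  cofactor (alt_mx m.+1 (p :: s)) ord0 j = cofactor (alt_mx m.+1 (q :: s)) ord0 j.
Proof.
congr (_ * \det _); apply/matrixP => i l.
by rewrite !mxE.
Qed.

(* The factor [\prod b] on the left keeps the exponent on the right from being a
   truncated subtraction when [s] is empty. *)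
Theorem cauchy_pfaffian s : ~~ odd (size s) -> uniq (map snd s) ->
  {in s, forall p, p.2 != 0} ->
  {in s &, forall p q, p != q -> 1 - p.2 * q.2 != 0} ->
  msum (-1) (fun p q => (q.1 - p.1) / (1 - p.2 * q.2)) s *
    pairprod (fun p q => 1 - p.2 * q.2) s * (\prod_(p <- s) p.2) =
  \det (alt_mx (size s) s) * (\prod_(p <- s) p.2) ^+ (size s)./2.
Proof.
elim/msum_ind: s => [|z s IH].
  by rewrite !mul1r big_nil det_mx00 mulr1.
move=> ods uzs s_neq0 s_adm.
have {ods} [n szs] : exists n, size s = n.*2.+1.
  move: ods; rewrite /= negbK => ods; exists (size s)./2.
  by rewrite -[LHS]odd_double_half ods.
have us : uniq s by apply: (map_uniq (f := snd)); case/andP: uzs.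
have usnd : uniq (map snd s) by case/andP: uzs.
have zs : z \notin s by have /andP[+ _] := map_uniq uzs.
set f := fun p q : K * K => _ / _; set g := fun p q : K * K => 1 - _.
have z0 : z.2 != 0 by rewrite s_neq0 ?mem_head.
have s'_neq0 : {in s, forall p, p.2 != 0}.
  by move=> x xs; rewrite s_neq0 // in_cons xs orbT.
have s'_adm : {in s &, forall p q, p != q -> g p q != 0}.
  by move=> x y xs ys; apply: s_adm; rewrite in_cons ?xs ?ys orbT.
have z_adm p : p \in s -> g z p != 0.
  move=> ps; apply: s_adm; rewrite ?mem_head // ?in_cons ?ps ?orbT //.
  by apply: contraNneq zs => ->.
set B := \prod_(p <- s) p.2.
have B0 : B != 0 by rewrite prodf_seq_neq0; apply/allP => p ps; apply: s'_neq0.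
pose c i := (-1) ^+ i * ((nth z s i).1 - z.1) * msum (-1) f (del i s).
(* [P] and [Q] are the two sides divided by [z.2], with [z.2] then replaced by ['X] and the
   denominators cleared; [z.1] stays fixed. *)
pose P : {poly K} := \sum_(i < size s)
  (c i * pairprod g s * B)%:P * \prod_(p <- del i s) (1 - p.2%:P * 'X).
pose cof j := cofactor (alt_mx n.+1.*2 (z :: s)) ord0 j.
(* The last factor is ['X^n] times the power [j./2] of ['X + 'X^-1], a polynomial because
   [j./2 <= n]. *)
pose Q : {poly K} := \sum_(j < n.+1.*2)
  (B ^+ n.+1 * (z.1 ^+ odd j * cof j))%:P * ('X^(n - j./2) * ('X^2 + 1) ^+ j./2).
have half_le (j : 'I_n.+1.*2) : (j./2 <= n)%N.
  by rewrite leq_half_double -ltnS -doubleS ltn_ord.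
have QE b : b != 0 -> Q.[b] = \det (alt_mx n.+1.*2 ((z.1, b) :: s)) * b ^+ n * B ^+ n.+1.
  move=> b0; rewrite (expand_det_row _ ord0) horner_sum !mulr_suml.
  apply: eq_bigr => j _; rewrite -(cofactor_head z) -/(cof j) mxE /alt_monomial /=.
  move: (cof j) => cj; rewrite !hornerE /recip.
  have -> : b ^+ n = b ^+ (n - j./2) * b ^+ j./2 by rewrite -exprD subnK.
  have -> : b ^+ 2 + 1 = b * (b + b^-1) by field.
  by rewrite exprMn /=; ring.
have PE b : P.[b] = \sum_(i < size s)
    c i * pairprod g s * B * \prod_(p <- del i s) (1 - p.2 * b).
  rewrite horner_sum; apply: eq_bigr => i _.
  rewrite hornerM hornerC horner_prod; congr (_ * _).
  by apply: eq_bigr => p _; rewrite !hornerE.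
suff PQ : P = Q.
  have E : P.[z.2] = Q.[z.2] by rewrite PQ.
  rewrite PE QE // -surjective_pairing in E.
  rewrite [size (z :: s)]/= szs -doubleS doubleK big_cons -/B.
  rewrite exprMn [z.2 ^+ _]exprS.
  transitivity (z.2 * (\det (alt_mx n.+1.*2 (z :: s)) * z.2 ^+ n * B ^+ n.+1)); last by ring.
  rewrite -E msum_cons !mulr_suml mulr_sumr; apply: eq_bigr => i _.
  rewrite /c [pairprod _ (z :: s)]/= (big_del (g z) z (ltn_ord i)) /f -/(g z (nth z s i)).
  have gzi := z_adm _ (mem_nth z (ltn_ord i)).
  rewrite (eq_bigr (fun p => 1 - p.2 * z.2)); last by move=> p _; rewrite /g mulrC.
  by field.
apply/eqP; rewrite -subr_eq0; apply/eqP.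
(* Both polynomials have degree at most [2n], so agreement at these [2n + 1] points suffices. *)
pose rs := [seq p.2^-1 | p <- s].
have urs : uniq rs.
  by rewrite -(map_inj_uniq (@invr_inj K)) -map_comp (eq_map (g := snd)) // => p /=; rewrite invrK.
have szrs : size rs = n.*2.+1 by rewrite size_map.
suff szPQ : (size (P - Q)%R <= n.*2.+1)%N.
  apply: contraTeq szPQ => PQ0; rewrite -ltnNge -szrs.
  apply: max_poly_roots PQ0 _ urs; apply/allP => _ /mapP[q qs ->].
  rewrite rootE hornerD hornerN subr_eq0; apply/eqP.
  have q0 := s'_neq0 q qs.
  have ltk : (index q s < size s)%N by rewrite index_mem.
  set k := Ordinal ltk; have qk : nth z s k = q by rewrite nth_index.
  have memd i p : (i < size s)%N -> p \in del i s -> (p != nth z s i) /\ (p \in s).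
    by move=> lti; rewrite (del_filter z us lti) mem_filter => /andP[].
  (* At [q.2^-1] the linear factor of [q] vanishes, leaving only the summand in which [q] is
     deleted. *)
  rewrite PE (bigD1 k) //= [X in _ + X]big1 ?addr0 => [|i ik]; last first.
    apply/eqP; rewrite mulf_eq0 prodf_seq_eq0; apply/orP; right; apply/hasP.
    exists q; last by rewrite /= divff // subrr.
    rewrite (del_filter z us (ltn_ord i)) mem_filter qs andbT -qk nth_uniq //.
    by rewrite eq_sym.
  rewrite -/(nat_of_ord k) QE ?invr_eq0 //.
  have ltk' : (index q s < n.*2.+1)%N by rewrite -szs.
  have := @det_alt_mx_collision n.*2 (z.1, q.2^-1) s (Ordinal ltk') szs.
  rewrite /= -/k (set_nth_default z) // -[index q s]/(nat_of_ord k) qk => ->; last first.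
    by rewrite /recip invrK addrC.
  set del_s := del k s; set E := \prod_(p <- del_s) (1 - _).
  set D := \det _; set R := \prod_(_ <- _) _.
  have memk p : p \in del_s -> (p != q) /\ (p \in s).
    by move=> /memd => /(_ ltk); rewrite qk.
  have szd : size del_s = n.*2 by rewrite (size_del ltk) szs.
  have BE : B = q.2 * \prod_(p <- del_s) p.2 by rewrite -qk; apply: big_del.
  have gg : forall x y, g x y = 1 * g y x by move=> x y; rewrite mul1r /g mulrC.
  rewrite (pairprod_del z gg ltk) -/del_s -[index q s]/(nat_of_ord k) qk expr1n mul1r.
  set G := \prod_(_ <- _) _.
  (* Factor by factor, [(1 - b_q b_p) (1 - b_p / b_q) = b_p (recip b_p - recip b_q)]. *)
  have keyGE : G * E = (\prod_(p <- del_s) p.2) * R.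
    rewrite -!big_split big_seq [RHS]big_seq; apply: eq_bigr => p /memk[_ ps].
    by rewrite /g /recip /=; field; rewrite q0 s'_neq0.
  have IHk : msum (-1) f del_s * pairprod g del_s * (\prod_(p <- del_s) p.2) =
      D * (\prod_(p <- del_s) p.2) ^+ n.
    have -> : D = \det (alt_mx (size del_s) del_s) by rewrite szd.
    have En : n = (size del_s)./2 by rewrite szd doubleK.
    rewrite [in RHS]En; apply: IH => //.
    - by rewrite -/del_s szd odd_double.
    - rewrite map_del (del_filter z.2) ?filter_uniq // size_map //.
    - by move=> p /memk[_ /s'_neq0].
    - by move=> p1 p2 /memk[_ p1s] /memk[_ p2s]; apply: s'_adm.
  rewrite /c qk -/del_s BE; move: keyGE IHk.
  set Bd := \prod_(_ <- del_s) _; set M := msum _ _ _; set PP := pairprod _ _ => keyGE IHk.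
  transitivity ((-1) ^+ k * (q.1 - z.1) * q.2 * (G * E) * (M * PP * Bd)); first by ring.
  by rewrite keyGE IHk exprMn exprVn !exprS; field; rewrite expf_neq0.
rewrite (leq_trans (size_polyD _ _)) // geq_max size_polyN; apply/andP; split.
  apply: size_sum_leq => i _; rewrite mul_polyC (leq_trans (size_scale_leq _ _)) //.
  have szd : size (del i s) = n.*2 by rewrite (size_del (ltn_ord i)) szs.
  rewrite -szd; apply: size_prod_linear => p.
  rewrite (leq_trans (size_polyD _ _)) // geq_max size_poly1 size_polyN /=.
  by rewrite mul_polyC (leq_trans (size_scale_leq _ _)) // size_polyX.
apply: size_sum_leq => j _; rewrite mul_polyC (leq_trans (size_scale_leq _ _)) //.
rewrite (leq_trans (size_polyMleq _ _)) // size_polyXn /=.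
have := size_poly_exp_leq ('X^2 + 1 : {poly K}) j./2.
have -> : size ('X^2 + 1 : {poly K}) = 3%N by rewrite size_XnaddC.
move: (half_le j) (size _) => /=; move: (nat_of_ord j)./2 => h hn k; lia.
Qed.

End CauchyPfaffian.

(** * The symplectic character of a double staircase *)

Lemma perm_delta_double k :
  perm_eq (rev (iota 0 k) ++ rev (iota 0 k)) (mkseq (fun j => k.-1 - j./2)%N k.*2).
Proof.
elim: k => // k IHk; rewrite -addn1 iotaD /= add0n rev_cat /= addn1 doubleS.
rewrite /mkseq /= subn0 perm_cons -cat_rcons -cats1 -catA /=.
rewrite perm_catC /= -cat_cons perm_cons.
rewrite (iotaDl 2 0) -map_comp perm_catC.
apply: perm_trans IHk _; rewrite /mkseq (eq_map (g := (fun j => k - j./2)%N \o addn 2)) //.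
by move=> j /=; lia.
Qed.

(** A non-increasing list is determined by its multiset of entries, so the sorted list is identified
    with an explicit one. *)
Lemma nth_delta2 n j : (0 < n)%N -> (j < n.*2)%N ->
  nth 0%N (delta2 (n%:Z - 1) (n%:Z - 1)) j = (n.-1 - j./2)%N.
Proof.
case: n => // m _ ltj; have -> : m.+1%:Z - 1 = m by rewrite -addn1 PoszD addrK.
have geq_tr : transitive geq by move=> a b c /= ba cb; apply: leq_trans cb ba.
rewrite -(nth_mkseq 0%N (fun j => m.+1.-1 - j./2)%N ltj); congr nth.
apply: (sorted_eq geq_tr).
- by move=> a b /andP[ba ab]; apply/eqP; rewrite eqn_leq; apply/andP.
- by apply: sort_sorted => a b; apply: leq_total.
- rewrite /mkseq sorted_map; apply: (sub_sorted _ (iota_sorted 0 _)) => a b /= ab.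
  by rewrite leq_sub2l // half_leq.
- by rewrite perm_sort; apply: perm_delta_double.
Qed.

Section Symplectic.
Variable K : fieldType.

Lemma det_scale_rows m (d : 'I_m -> K) (A : 'I_m -> 'I_m -> K) :
  \det (\matrix_(i, j) (d i * A i j)) = (\prod_i d i) * \det (\matrix_(i, j) A i j).
Proof.
have -> : \matrix_(i, j) (d i * A i j) = diag_mx (\row_i d i) *m \matrix_(i, j) A i j.
  by apply/matrixP => i j; rewrite mul_diag_mx !mxE.
by rewrite det_mulmx det_diag; congr (_ * _); apply: eq_bigr => i _; rewrite mxE.
Qed.

(** The symplectic determinants list exponents decreasingly; the sign of the reversal is common to
    numerator and denominator and cancels in [Sp]. *)
Lemma det_rev_cols m (A : 'I_m -> 'I_m -> K) :
  \det (\matrix_(i, j) A i (rev_ord j)) =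
    (-1) ^+ perm (@rev_ord_inj m) * \det (\matrix_(i, j) A i j).
Proof.
have -> : \matrix_(i, j) A i (rev_ord j) =
    col_perm (perm (@rev_ord_inj m)) (\matrix_(i, j) A i j).
  by apply/matrixP => i j; rewrite !mxE permE.
by rewrite col_permE det_mulmx det_perm odd_permV mulrC.
Qed.

(** Chebyshev polynomials of the second kind, normalised to be monic: they express
    [(z^(j+1) - z^-(j+1)) / (z - z^-1)] through [z + z^-1]. *)
Fixpoint cheb_poly (j : nat) : {poly K} :=
  match j with
  | 0 => 1
  | 1 => 'X
  | (j2.+1 as j1).+1 => 'X * cheb_poly j1 - cheb_poly j2
  end.

(* Here 'X^l stands for [alt_monomial (z + z^-1, z ^+ 3) l], so that multiplying
   by 'X^2 multiplies by [z ^+ 3 + z ^- 3]. *)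
Fixpoint alt_cheb_poly (j : nat) : {poly K} :=
  match j with
  | 0 => 1
  | 1 => 'X
  | 2 => 'X^2 + 'X
  | 3 => 'X^3 + 1
  | ((j4.+1).+1 as j2).+2 => 'X^2 * alt_cheb_poly j2 - alt_cheb_poly j4
  end.

Lemma monic_step (p q : {poly K}) k : p \is monic -> (size q < k + size p)%N ->
  ('X^k * p - q \is monic) * (size ('X^k * p - q)%R = k + size p)%N.
Proof.
move=> mp szq; have mXp : 'X^k * p \is monic by rewrite monicMl ?monicXn.
have szXp : size ('X^k * p) = (k + size p)%N.
  by rewrite size_monicM ?monicXn ?monic_neq0 // size_polyXn.
split; last by rewrite size_polyDl ?size_polyN szXp.
by rewrite monicE lead_coefDl ?size_polyN ?szXp // (monicP mXp).
Qed.

Lemma cheb_polyP j : cheb_poly j \is monic /\ size (cheb_poly j) = j.+1.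
Proof.
elim/ltn_ind: j => -[|[|j]] IHj; first by rewrite monic1 size_poly1.
  by rewrite /= monicX size_polyX.
have [[m1 s1] [_ s0]] := (IHj j.+1 (ltnSn _), IHj j (ltnW (ltnSn _))).
rewrite -[cheb_poly j.+2]/('X^1 * cheb_poly j.+1 - cheb_poly j).
by have [|-> ->] := @monic_step _ (cheb_poly j) 1 m1; rewrite ?s0 s1.
Qed.

Lemma alt_cheb_polyP j : alt_cheb_poly j \is monic /\ size (alt_cheb_poly j) = j.+1.
Proof.
elim/ltn_ind: j => -[|[|[|[|j]]]] IHj.
- by rewrite monic1 size_poly1.
- by rewrite /= monicX size_polyX.
(* The initial values at 2 and 3 obey the recursion as well: the subtracted terms belong to the
   exponents -2 and -1, which give [- 'X] and [- 1]. *)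
- have [|] := @monic_step 1 (- 'X) 2 (monic1 _).
    by rewrite size_polyN size_polyX size_poly1.
  by rewrite mulr1 opprK size_poly1 => -> ->.
- have [|] := @monic_step 1 (- 1) 3 (monic1 _).
    by rewrite size_polyN size_poly1.
  by rewrite mulr1 opprK size_poly1 => -> ->.
have lt4 : (j < j.+4)%N by lia.
have [[m1 s1] [_ s0]] := (IHj j.+2 (ltnW (ltnSn _)), IHj j lt4).
rewrite -[alt_cheb_poly j.+4]/('X^2 * alt_cheb_poly j.+2 - alt_cheb_poly j).
have [|-> ->] := @monic_step _ (alt_cheb_poly j) 2 m1; rewrite ?s0 s1 //.
Qed.

Lemma cheb_polyE (z : K) j : z != 0 ->
  (z - z^-1) * (cheb_poly j).[recip z] = z ^+ j.+1 - z ^- j.+1.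
Proof.
move=> z0; elim/ltn_ind: j => -[|[|j]] IHj.
- by rewrite hornerE mulr1.
- by rewrite /= hornerX /recip; field.
have [E1 E0] := (IHj j.+1 (ltnSn _), IHj j (ltnW (ltnSn _))).
rewrite /= hornerD hornerN hornerM hornerX mulrBr mulrCA E1 E0 /recip !exprS.
by field; rewrite z0 expf_neq0.
Qed.

(** Raising [j] by 2 raises the exponent by 3, so the recursion is
    [z^(m+6) + z^m = z^(m+3) (z^3 + z^-3)]. The exponents run through 1, 2, 4, 5, 7, 8, and so
    on. *)
Lemma alt_cheb_polyE (z : K) j : z != 0 ->
  (z - z^-1) * umbral (alt_monomial (recip z, z ^+ 3)) (alt_cheb_poly j) =
  z ^+ (j + j./2).+1 - z ^- (j + j./2).+1.
Proof.
move=> z0; set phi := alt_monomial _.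
have phi0 : phi 0%N = 1 by rewrite /phi /alt_monomial mulr1.
have phi1 : phi 1%N = recip z by rewrite /phi /alt_monomial mulr1.
have phiD l : phi (2 + l)%N = recip (z ^+ 3) * phi l.
  by rewrite /phi /alt_monomial /= negbK exprS; ring.
have umbral2 p : umbral phi ('X^2 * p) = recip (z ^+ 3) * umbral phi p.
  by rewrite umbral_mulXn -umbral_scale; apply: eq_bigr => l _; rewrite phiD.
have u0 : umbral phi 1 = 1 by have := umbralXn phi 0; rewrite phi0.
have u1 : umbral phi 'X = recip z by have := umbralXn phi 1; rewrite phi1.
elim/ltn_ind: j => -[|[|[|[|j]]]] IHj.
- by rewrite /= u0 mulr1.
- by rewrite /= u1 /recip; field.
- by rewrite /= umbralD u1 -['X^2]mulr1 umbral2 u0 /recip; field.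
- by rewrite /= umbralD u0 exprSr umbral2 u1 /recip; field.
have lt4 : (j < j.+4)%N by lia.
have [E1 E0] := (IHj j.+2 (ltnW (ltnSn _)), IHj j lt4).
rewrite [alt_cheb_poly _]/= -/(alt_cheb_poly j.+2) umbralB umbral2 mulrBr mulrCA E1 E0.
rewrite /recip /= !(addSn, addnS) !exprS.
by field; rewrite z0 expf_neq0.
Qed.

(** Row [i] of both determinants has the factor [z_i - z_i^-1]. The quotients are unitriangular
    combinations of the [alt_monomial] functions above, and of powers of [recip z_i] below, where a
    Vandermonde determinant results. *)
Lemma Sp_double_staircase n (z : 'I_(2 * n) -> K) : (0 < n)%N ->
  (forall i, z i != 0) -> (forall i, z i ^+ 2 != 1) ->
  Sp (delta2 (n%:Z - 1) (n%:Z - 1)) z =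
    \det (alt_mx (2 * n) [seq (recip (z i), z i ^+ 3) | i <- enum 'I_(2 * n)]) /
    \prod_(i < 2 * n) \prod_(j < 2 * n | (i < j)%N) (recip (z j) - recip (z i)).
Proof.
move=> n0 z0 z1; rewrite /Sp.
have d0 : \prod_i (z i - (z i)^-1) != 0.
  apply/prodf_neq0 => i _; rewrite subr_eq0; apply: contra (z1 i) => /eqP E.
  by rewrite expr2 {1}E mulVf.
pose N i (j : 'I_(2 * n)) := z i ^+ (j + j./2).+1 - z i ^- (j + j./2).+1.
pose M i (j : 'I_(2 * n)) := z i ^+ j.+1 - z i ^- j.+1.
have revE (j : 'I_(2 * n)) : (2 * n - j = (rev_ord j).+1)%N.
  by rewrite /= subnSK.
have -> : symplectic_num (delta2 (n%:Z - 1) (n%:Z - 1)) z = \det (\matrix_(i, j) N i (rev_ord j)).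
  congr (\det _); apply/matrixP => i j; rewrite !mxE nth_delta2 -?mul2n // revE /N.
  (* For [l = 2n - 1 - j] one has [l./2 = n - 1 - j./2], which is exactly the part of the partition
     at [j]. *)
  have -> : ((n.-1 - j./2) + (rev_ord j).+1 = (rev_ord j + (rev_ord j)./2).+1)%N.
    have := ltn_ord j; move: n0; rewrite /=; move: (nat_of_ord j) => l; lia.
  by [].
have -> : symplectic_num [::] z = \det (\matrix_(i, j) M i (rev_ord j)).
  congr (\det _); by apply/matrixP => i j; rewrite !mxE nth_nil add0n revE.
rewrite !det_rev_cols.
have -> : \det (\matrix_(i, j) N i j) = (\prod_i (z i - (z i)^-1)) *
    \det (alt_mx (2 * n) [seq (recip (z i), z i ^+ 3) | i <- enum 'I_(2 * n)]).
  set pts := map _ _.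
  rewrite -[\det (alt_mx _ _)](det_umbral (fun i => alt_monomial (nth (0, 0) pts i)) (fun j => (alt_cheb_polyP j).1)
    (fun j => (alt_cheb_polyP j).2)) -det_scale_rows; congr (\det _).
  apply/matrixP => i j; rewrite !mxE /N (nth_map i) ?size_enum_ord //.
  by rewrite nth_ord_enum alt_cheb_polyE.
have -> : \det (\matrix_(i, j) M i j) = (\prod_i (z i - (z i)^-1)) *
    \prod_(i < 2 * n) \prod_(j < 2 * n | (i < j)%N) (recip (z j) - recip (z i)).
  pose V := Vandermonde (2 * n) (\row_i recip (z i)).
  transitivity ((\prod_i (z i - (z i)^-1)) * \det V^T).
    have -> : V^T = \matrix_(i, j) recip (z i) ^+ j.
      by apply/matrixP => i j; rewrite !mxE.
    rewrite -(det_umbral (fun i l => recip (z i) ^+ l) (fun j => (cheb_polyP j).1)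
      (fun j => (cheb_polyP j).2)) -det_scale_rows; congr (\det _).
    by apply/matrixP => i j; rewrite !mxE umbral_exp cheb_polyE.
  rewrite det_tr det_Vandermonde; congr (_ * _); apply: eq_bigr => i _.
  by apply: eq_bigr => j _; rewrite !mxE.
rewrite -mulf_div -mulf_div !divff ?mul1r // signr_eq0 //.
Qed.

End Symplectic.

(** * Specialisations of A_OD *)

(** As [n^2 - n] is even, the exponent of [sigma a] is a multiple of 4, so the value of
    [sigma a ^+ 4] decides the prefactor. *)
Lemma exponent_even (n : nat) :
  exists m : int, - 2 * n%:Z ^+ 2 + 2 * n%:Z = 4%:Z * m /\ - n%:Z ^+ 2 + n%:Z = 2%:Z * m.
Proof.
exists (- ('C(n, 2))%:Z).
have E : (n%:Z ^+ 2 = n%:Z + 2 * ('C(n, 2))%:Z).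
  elim: n => // n IHn; rewrite binS bin1 PoszD -addn1 PoszD.
  by rewrite sqrrD IHn; ring.
by rewrite E; split; ring.
Qed.

Section Specialisations.
Variables (K : fieldType) (n : nat) (n_gt0 : (0 < n)%N) (x : 'I_(2 * n) -> K).
Hypothesis x_neq0 : forall i, x i != 0.
Hypothesis x_exp6_inj : injective (fun i => x i ^+ 6).
(** As 4 and 6 divide 12, one condition keeps both [1 + x_i^2 x_j^2] and [1 - x_i^6 x_j^6] away from
    zero. *)
Hypothesis x_adm : forall i j, (x i * x j) ^+ 12 != 1.

Let xx_neq0 i j : x i * x j != 0. Proof. by rewrite mulf_neq0. Qed.

Let sqr_inj : injective (fun i => x i ^+ 2).
Proof. by move=> i j /= E; apply: x_exp6_inj; rewrite /= (exprM _ 2 3) E -exprM. Qed.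

Let prod_pairs (g : 'I_(2 * n) -> 'I_(2 * n) -> K) :
  \prod_(i < 2 * n) \prod_(j < 2 * n | (i < j)%N) g i j = pairprod g (enum 'I_(2 * n)).
Proof. by rewrite pairprod_enum. Qed.

Let sigma_div i j : sigma (x j / x i) = x j / x i - x i / x j.
Proof. by rewrite /sigma invf_div. Qed.

Let F_ODE a : F_OD x a = pairprod (fun i j =>
  sigma (a * x i * x j) * sigma (a / (x i * x j)) / sigma (x j / x i)) (enum 'I_(2 * n)).
Proof. by rewrite /F_OD !prod_pairs -pairprodV -pairprodM. Qed.

Let xx4 i j : (x i * x j) ^+ 2 + 1 != 0.
Proof.
apply: contra (x_adm i j); rewrite addr_eq0 => /eqP E.
by rewrite (exprM _ 2 6) E -signr_odd.
Qed.

Let sqrB i j : i != j -> x j ^+ 2 - x i ^+ 2 != 0.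
Proof. by move=> ij; rewrite subr_eq0 eq_sym (inj_eq sqr_inj). Qed.

(** Since [a^-1 = - a], both sigma factors of a pair equal [a (t + t^-1)] with [t = x_i x_j]. Taking
    [a x_i] out of rows and columns leaves the kernel of [pfaffian_hafnian] at the squares
    [x_i^2]. *)
Theorem A_OD_zeta4 (a : K) : a ^+ 2 = -1 ->
  A_OD x a =
    2 ^ (- 2 * n%:Z ^+ 2 + 2 * n%:Z)
    * (\prod_(i < 2 * n) x i ^ (- 2 * n%:Z + 2))
    * (\prod_(i < 2 * n) \prod_(j < 2 * n | (i < j)%N)
         (1 + x i ^+ 2 * x j ^+ 2))
    * Hf (\matrix_(i < 2 * n, j < 2 * n) (1 + x i ^+ 2 * x j ^+ 2)^-1).
Proof.
move=> a2; have a0 : a != 0.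
  by apply: contra_eq_neq a2 => ->; rewrite expr0n eq_sym oppr_eq0 oner_eq0.
have aV : a^-1 = - a by apply: (mulfI a0); rewrite divff // mulrN -expr2 a2 opprK.
have sigma1 t : sigma (a * t) = a * (t + t^-1).
  by rewrite /sigma invfM aV mulNr opprK mulrDr.
have sigma2 t : sigma (a / t) = a * (t + t^-1).
  by rewrite sigma1 invrK addrC.
rewrite /A_OD F_ODE Pf_msum // Hf_msum // prod_pairs.
have -> : sigma a ^ (- 2 * n%:Z ^+ 2 + 2 * n%:Z) = 2 ^ (- 2 * n%:Z ^+ 2 + 2 * n%:Z).
  have [m [-> _]] := exponent_even n; rewrite -!exprz_exp; congr (_ ^ m).
  have -> : sigma a = 2 * a by rewrite /sigma aV opprK; ring.
  by rewrite -!exprnP exprMn (exprM a 2 2) a2 sqrrN expr1n mulr1.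
set e := 2 ^ _; set I := enum _; pose s := [seq x i ^+ 2 | i <- I].
pose g (p q : K) := (q - p) / (1 + p * q).
have uI : uniq I by apply: enum_uniq.
have -> : pairprod (fun i j =>
    sigma (a * x i * x j) * sigma (a / (x i * x j)) / sigma (x j / x i)) I =
  (\prod_(i <- I) (a / x i)) ^+ (2 * n).-1 *
    (pairprod (fun i j => 1 + x i ^+ 2 * x j ^+ 2) I /
     pairprod (fun i j => g (x i ^+ 2) (x j ^+ 2)) I).
  have := pairprod_mul (fun i => a / x i) I; rewrite size_enum_ord => <-.
  rewrite -pairprodV -!pairprodM; apply: eq_pairprod => // i j _ _ ij.
  rewrite sigma2 -(mulrA a) sigma1 sigma_div /g.
  have := sqrB ij; have := xx4 i j; have := x_neq0 i; have := x_neq0 j.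
  move: (x i) (x j) => y z z0 y0; rewrite addrC => yz d.
  transitivity (a ^+ 2 * (y * z + (y * z)^-1) ^+ 2 / (z / y - y / z)).
    by field; rewrite z0 y0 mulNr -!expr2 d.
  by field; rewrite yz d z0 y0.
have us : uniq s by rewrite map_inj_uniq.
have szs : ~~ odd (size s) by rewrite size_map size_enum_ord mul2n odd_double.
have s_neq0 : {in s, forall p, p != 0}.
  by move=> _ /mapP[i _ ->]; rewrite expf_neq0.
have s_adm : {in s &, forall p q, p != q -> 1 + p * q != 0}.
  by move=> _ _ /mapP[i _ ->] /mapP[j _ ->] _; rewrite -exprMn addrC.
have PfHf : msum (-1) (fun i j => (x j ^+ 2 - x i ^+ 2) / (1 + x i ^+ 2 * x j ^+ 2) ^+ 2) I =
    pairprod (fun i j => g (x i ^+ 2) (x j ^+ 2)) I *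
    msum 1 (fun i j => (1 + x i ^+ 2 * x j ^+ 2)^-1) I.
  by have := pfaffian_hafnian szs us s_neq0 s_adm; rewrite pairprod_map !msum_map.
have -> : msum (-1) (fun i j => M_OD x a i j) I = (\prod_(i <- I) (a * x i)) *
    msum (-1) (fun i j => (x j ^+ 2 - x i ^+ 2) / (1 + x i ^+ 2 * x j ^+ 2) ^+ 2) I.
  rewrite -msum_scale; apply: eq_msum => // i j _ _ ij.
  rewrite mxE sigma2 -(mulrA a) sigma1 sigma_div.
  have := sqrB ij; have := xx4 i j; have := x_neq0 i; have := x_neq0 j.
  move: (x i) (x j) => y z z0 y0 yz d.
  have yz' : 1 + y ^+ 2 * z ^+ 2 != 0 by rewrite -exprMn addrC.
  have a2V : (a ^+ 2)^-1 = a ^+ 2 by rewrite a2 invrN invr1.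
  transitivity ((z / y - y / z) / (y * z + (y * z)^-1) ^+ 2 * a ^+ 2).
    by rewrite mulrACA -!expr2 invfM a2V mulrCA mulrC.
  by field; rewrite addrC yz z0 y0.
rewrite PfHf.
have -> : msum 1 (fun i j => (\matrix_(i0, j0) (1 + x i0 ^+ 2 * x j0 ^+ 2)^-1) i j) I =
    msum 1 (fun i j => (1 + x i ^+ 2 * x j ^+ 2)^-1) I.
  by apply: eq_msum => // i j _ _ _; rewrite mxE.
set H := msum 1 _ _; set G := pairprod (fun i j => g _ _) I; set W := pairprod _ I.
have G0 : G != 0.
  apply: pairprod_neq0 => // i j _ _ ij; rewrite /g mulf_neq0 ?sqrB //.
  by rewrite invr_eq0 -exprMn addrC.
(* Each variable collects [a^(2n) x_i^(2-2n)], and the powers of [a] multiply to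
   [(a^2)^(2n^2) = 1]. *)
have E : (\prod_(i <- I) (a / x i)) ^+ (2 * n).-1 * (\prod_(i <- I) (a * x i)) =
    \prod_(i < 2 * n) x i ^ (- 2 * n%:Z + 2).
  rewrite !big_enum -prodrXl -big_split /=.
  rewrite (eq_bigr (fun i => a ^+ (2 * n) * x i ^ (- 2 * n%:Z + 2))); last first.
    move=> i _; have xi := x_neq0 i.
    have -> : - 2 * n%:Z = - (2 * n)%N%:Z by lia.
    rewrite expfzDr // -exprnN -[x i ^ 2]/(x i ^+ 2).
    have [k ->] : exists k, (2 * n = k.+1)%N by exists (2 * n).-1%N; rewrite prednK ?muln_gt0.
    by rewrite expr_div_n !exprS /=; field; rewrite expf_neq0 xi.
  rewrite big_split prodr_const card_ord -exprM -mulnA exprM a2.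
  by rewrite -signr_odd mulnCA oddM expr0 /= mul1r.
by rewrite -E; field.
Qed.

(** Since [a^-1 = 1 - a], the entries are [x_i^3 x_j^3] times the kernel of [cauchy_pfaffian] at the
    points [(alpha_i, b_i)], and the resulting determinant is the one in [Sp_double_staircase]. *)
Theorem A_OD_zeta6 (a : K) : a ^+ 2 - a + 1 = 0 ->
  A_OD x a =
    3 ^ (- n%:Z ^+ 2 + n%:Z)
    * Sp (delta2 (n%:Z - 1) (n%:Z - 1)) (fun i : 'I_(2 * n) => x i ^+ 2).
Proof.
move=> a_root; have a2 : a ^+ 2 = a - 1.
  by rewrite -[RHS]addr0 -a_root; ring.
have a0 : a != 0.
  by apply: contra_eq_neq a2 => ->; rewrite expr0n /= eq_sym sub0r oppr_eq0 oner_eq0.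
have aa : a * (1 - a) = 1 by rewrite mulrBr mulr1 -expr2 a2 opprB addrCA subrr addr0.
have aV : a^-1 = 1 - a by apply: (mulfI a0); rewrite divff.
pose b i := (x i ^+ 2) ^+ 3; pose alpha i := recip (x i ^+ 2).
have t2_neq0 i j : 1 - (x i * x j) ^+ 2 != 0.
  rewrite subr_eq0 eq_sym; apply: contra (x_adm i j) => /eqP E.
  by rewrite (exprM _ 2 6) E expr1n.
have alphaB i j : alpha j - alpha i =
    (x i ^+ 2 - x j ^+ 2) * (1 - (x i * x j) ^+ 2) / (x i * x j) ^+ 2.
  by rewrite /alpha /recip; field; rewrite !x_neq0.
have alphaB_neq0 i j : i != j -> alpha j - alpha i != 0.
  by move=> ij; rewrite alphaB !mulf_neq0 ?invr_eq0 ?expf_neq0 // sqrB // eq_sym.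
have b_adm i j : 1 - b i * b j != 0.
  rewrite subr_eq0 eq_sym /b -exprMn -exprMn -exprM.
  by apply: contra (x_adm i j) => /eqP E; rewrite (exprM _ 6 2) E expr1n.
have sigmaM t : t != 0 -> sigma (a * t) * sigma (a / t) = - (t ^+ 4 + t ^+ 2 + 1) / t ^+ 2.
  move=> t0; rewrite /sigma !invfM invrK aV.
  transitivity (a ^+ 2 + (1 - 2 * a + a ^+ 2) - (a * (1 - a)) * (t ^+ 2 + t ^- 2)).
    by field.
  by rewrite aa a2; field.
(* [t^4 + t^2 + 1 = (1 - t^6) / (1 - t^2)], and [t^6 = b_i b_j] for [t = x_i x_j]. *)
have sigmaE i j : sigma (a * x i * x j) * sigma (a / (x i * x j)) =
    - (1 - b i * b j) / ((1 - (x i * x j) ^+ 2) * (x i * x j) ^+ 2).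
  rewrite -mulrA sigmaM // /b -!exprMn; have := xx_neq0 i j; have := t2_neq0 i j.
  by move: (x i * x j) => t t1 t0; field; rewrite t0 t1.
rewrite /A_OD F_ODE Pf_msum //.
have -> : sigma a ^ (- 2 * n%:Z ^+ 2 + 2 * n%:Z) = 3 ^ (- n%:Z ^+ 2 + n%:Z).
  have [m [-> ->]] := exponent_even n; rewrite -!exprz_exp; congr (_ ^ m).
  rewrite -!exprnP (exprM _ 2 2) /sigma aV.
  (* As [a^2 - a = -1], the square of [sigma a] is -3 and its fourth power is [3^2]. *)
  have -> : (a - (1 - a)) ^+ 2 = 4 * (a ^+ 2 - a) + 1 by ring.
  by rewrite a2; ring.
rewrite Sp_double_staircase //; last first.
- move=> i; apply: contra (x_adm i i) => /eqP E.
  by rewrite -expr2 -exprM (exprM _ 4 6) (exprM _ 2 2) E expr1n.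
- by move=> i; rewrite expf_neq0.
set e := 3 ^ _; set I := enum _; set s := map _ I.
have uI : uniq I by apply: enum_uniq.
have szs : size s = (2 * n)%N by rewrite size_map size_enum_ord.
have CP : msum (-1) (fun i j => (alpha j - alpha i) / (1 - b i * b j)) I *
    pairprod (fun i j => 1 - b i * b j) I * (\prod_(i <- I) b i) =
    \det (alt_mx (2 * n) s) * (\prod_(i <- I) b i) ^+ n.
  have ods : ~~ odd (size s) by rewrite szs mul2n odd_double.
  have us2 : uniq (map snd s).
    by rewrite -map_comp map_inj_uniq // => i j /=; rewrite -!exprM; apply: x_exp6_inj.
  have s_neq0 : {in s, forall p, p.2 != 0}.
    by move=> _ /mapP[i _ ->] /=; rewrite !expf_neq0.
  have s_adm : {in s &, forall p q, p != q -> 1 - p.2 * q.2 != 0}.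
    by move=> _ _ /mapP[i _ ->] /mapP[j _ ->] _; apply: b_adm.
  have En : n = (size s)./2 by rewrite szs mul2n doubleK.
  have := cauchy_pfaffian ods us2 s_neq0 s_adm.
  by rewrite -En msum_map pairprod_map !big_map szs.
pose X3 := \prod_(i <- I) x i ^+ 3.
have X30 : X3 != 0 by rewrite prodf_seq_neq0; apply/allP => i _ /=; rewrite expf_neq0.
have bX : \prod_(i <- I) b i = X3 ^+ 2.
  by rewrite /X3 !big_enum -prodrXl; apply: eq_bigr => i _; rewrite /b -!exprM.
have -> : pairprod (fun i j =>
    sigma (a * x i * x j) * sigma (a / (x i * x j)) / sigma (x j / x i)) I =
  X3^-1 ^+ (2 * n).-1 * (pairprod (fun i j => 1 - b i * b j) I /
     pairprod (fun i j => alpha j - alpha i) I).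
  have := pairprod_mul (fun i => (x i ^+ 3)^-1) I; rewrite size_enum_ord prodfV => <-.
  rewrite -pairprodV -!pairprodM; apply: eq_pairprod => // i j _ _ ij.
  rewrite sigmaE sigma_div alphaB; move: (t2_neq0 i j) (sqrB ij) (x_neq0 i) (x_neq0 j).
  rewrite eq_sym in ij; move: (sqrB ij) (b i * b j).
  move: (x i) (x j) => y z d' bb t0 d y0 z0.
  by field; rewrite z0 y0 t0 d' mulNr -!expr2 d.
have -> : msum (-1) (fun i j => M_OD x a i j) I =
    X3 * msum (-1) (fun i j => (alpha j - alpha i) / (1 - b i * b j)) I.
  rewrite -msum_scale; apply: eq_msum => // i j _ _ ij.
  rewrite mxE sigmaE sigma_div alphaB.
  move: (t2_neq0 i j) (x_neq0 i) (x_neq0 j) (b_adm i j); move: (b i * b j).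
  move: (x i) (x j) => y z bb t0 y0 z0 bb0.
  by field; rewrite bb0 y0 z0 t0 oppr_eq0 bb0.
rewrite prod_pairs -/I.
have AA0 : pairprod (fun i j => recip (x j ^+ 2) - recip (x i ^+ 2)) I != 0.
  by apply: pairprod_neq0 => // i j _ _; apply: alphaB_neq0.
move: CP AA0; rewrite bX /alpha.
set AA := pairprod (fun i j => recip _ - _) I; set PP := pairprod _ I; set M := msum _ _ I.
move=> CP AA0.
(* Both sides of the claim now carry the factor [X3^(2 - 2n)], so no power of the variables
   remains. *)
have -> : \det (alt_mx (2 * n) s) = M * PP * X3 ^+ 2 / (X3 ^+ 2) ^+ n.
  by rewrite CP mulfK // !expf_neq0.
have [k kE] : exists k, (2 * n = k.+1)%N by exists (2 * n).-1%N; rewrite prednK ?muln_gt0.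
rewrite -exprM kE /= exprVn (exprS _ k).
by field; rewrite AA0 X30 expf_neq0.
Qed.
End Specialisations.

(** * Algebraic equations of the two roots of unity *)

Section Zeta.
Variable R : realType.

Lemma zeta4_sqr : zeta R 4 ^+ 2 = -1.
Proof.
have -> : zeta R 4 = Complex 0 1.
  rewrite /zeta; have -> : 2 * (trigo.pi : R) / 4%:R = trigo.pi / 2 by field.
  by rewrite trigo.cos_pihalf trigo.sin_pihalf.
by rewrite expr2; apply/eqP; rewrite eq_complex /= !mulr0 !mul0r mulr1 sub0r addr0 oppr0 !eqxx.
Qed.

Lemma zeta6_root : zeta R 6 ^+ 2 - zeta R 6 + 1 = 0.
Proof.
rewrite /zeta; have -> : 2 * (trigo.pi : R) / 6%:R = trigo.pi / 3 by field.
set t := trigo.pi / 3; set c := trigo.cos t; set s := trigo.sin t.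
have cs : c ^+ 2 + s ^+ 2 = 1 by apply: trigo.cos2Dsin2.
have c_gt0 : 0 < c.
  apply: trigo.cos_gt0_pihalf.
  have := trigo.pi_gt0 R; rewrite /t => pi0; apply/andP; split; lra.
(* The triple-angle formula at [3t = pi]. The cubic factors as [(c + 1) (2c - 1)^2], and [c > 0]
   leaves [c = 1/2]. *)
have c3 : 4 * c ^+ 3 - 3 * c = -1.
  rewrite -(trigo.cospi R) (_ : trigo.pi = t + (t + t)); last by rewrite /t; field.
  rewrite !trigo.cosD trigo.sinD -/c -/s.
  have -> : s * (s * c + c * s) = 2 * c * s ^+ 2 by ring.
  have -> : c * (c * c - s * s) = c ^+ 3 - c * s ^+ 2 by ring.
  have -> : s ^+ 2 = 1 - c ^+ 2 by rewrite -cs addrC addKr.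
  by ring.
have c2 : 2 * c = 1.
  have /eqP : (c + 1) * (2 * c - 1) ^+ 2 = 0.
    by transitivity (4 * c ^+ 3 - 3 * c + 1); [ring | rewrite c3 addNr].
  rewrite mulf_eq0 expf_eq0 /= gt_eqF /= ?addr_gt0 // subr_eq0.
  by move=> /eqP.
have s2 : s ^+ 2 = 1 - c ^+ 2 by rewrite -cs addrC addKr.
apply/eqP; rewrite expr2 eq_complex /=; apply/andP; split; apply/eqP.
  have -> : c * c - s * s - c + 1 = c ^+ 2 - s ^+ 2 - c + 1 by ring.
  rewrite s2; transitivity (c * (2 * c - 1)); first by ring.
  by rewrite c2 subrr mulr0.
transitivity (s * (2 * c - 1)); first by ring.
by rewrite c2 subrr mulr0.
Qed.

End Zeta.

(** * Genericity of the indeterminates *)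

Section RatFun.
Variables (R : realType) (N : nat).
Local Notation x := (@indet R N).

Lemma indet_neq0 i : x i != 0.
Proof.
rewrite tofrac_eq0; apply: contraTneq isT => X0.
have := congr1 (mcoeff U_(i)) X0; rewrite mcoeffX eqxx mcoeff0 => /eqP.
by rewrite oner_eq0.
Qed.

Lemma mpolyX_inj (m k : 'X_{1.. N}) : 'X_[R[i], m] = 'X_[k] -> m = k.
Proof.
move/(congr1 (mcoeff k)); rewrite !mcoeffX eqxx => /eqP.
by case: (m =P k) => // _; rewrite eq_sym oner_eq0.
Qed.

Lemma indet_exp_inj k : (0 < k)%N -> injective (fun i => x i ^+ k).
Proof.
move=> k0 i j /eqP; rewrite -!tofracXn tofrac_eq !mpolyXn => /eqP/mpolyX_inj/mnmP/(_ i).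
rewrite !mulmnE !mnm1E eqxx mul1n; case: (j =P i) => // _.
by rewrite mul0n => k_eq0; rewrite k_eq0 in k0.
Qed.

(** The exponent of [x i] in this monomial is at least [k], also when [i = j], whereas it is 0 in
    the constant 1. *)
Lemma indet_mul_exp_neq1 k i j : (0 < k)%N -> (x i * x j) ^+ k != 1.
Proof.
move=> k0; rewrite -tofracM -tofracXn -tofrac1 tofrac_eq -mpolyXD mpolyXn -mpolyX0.
apply: contraTneq k0 => /mpolyX_inj/mnmP/(_ i).
rewrite mulmnE mnmDE !mnm1E eqxx mnm0E => /eqP.
by rewrite muln_eq0 => /eqP ->.
Qed.

End RatFun.

Theorem theorem2p4 (R : realType) (n : nat) (n_ge1 : (1 <= n)%N) :
  let x : 'I_(2 * n) -> ratfun R (2 * n) := fun i => indet R i in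
  A_OD x (ratfun_const (2 * n) (zeta R 4)) =
    2 ^ (- 2 * n%:Z ^+ 2 + 2 * n%:Z)
    * (\prod_(i < 2 * n) x i ^ (- 2 * n%:Z + 2))
    * (\prod_(i < 2 * n) \prod_(j < 2 * n | (i < j)%N)
         (1 + x i ^+ 2 * x j ^+ 2))
    * Hf (\matrix_(i < 2 * n, j < 2 * n) (1 + x i ^+ 2 * x j ^+ 2)^-1)
  /\
  A_OD x (ratfun_const (2 * n) (zeta R 6)) =
    3 ^ (- n%:Z ^+ 2 + n%:Z)
    * Sp (delta2 (n%:Z - 1) (n%:Z - 1)) (fun i : 'I_(2 * n) => x i ^+ 2).
Proof.
move=> x.
have x_neq0 i : x i != 0 by apply: indet_neq0.
have x_inj : injective (fun i => x i ^+ 6) by apply: indet_exp_inj.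
have x_adm i j : (x i * x j) ^+ 12 != 1 by apply: indet_mul_exp_neq1.
split.
  apply: A_OD_zeta4 => //.
  by rewrite /ratfun_const -tofracXn -rmorphXn zeta4_sqr rmorphN1 tofracN tofrac1.
apply: A_OD_zeta6 => //; rewrite /ratfun_const -tofracXn -rmorphXn.
by rewrite -tofracB -tofrac1 -tofracD -mpolyC1 -rmorphB -rmorphD zeta6_root !rmorph0.
Qed.
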